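(* Let $\Omega^\delta$ be a discrete domain, $\varpi:\widetilde\Omega^\delta\to\Omega^\delta$ a double cover, $a\in\partial\widetilde\Omega^\delta$ a boundary half-edge, and $F_\varpi(a,\cdot)$ the spinor observable. Then: (i) for every corner $c\in\Upsilon(\widetilde\Omega^\delta)$ formed by two edges or half-edges $z',z''\in\mathcal E(\widetilde\Omega^\delta)$ (both incident to the vertex of $c$ and bounding the face of $c$), $$\Pr_{\eta_c}(F_\varpi(a,z'))=\Pr_{\eta_c}(F_\varpi(a,z''));$$ (ii) for every boundary half-edge $b\in\partial\widetilde\Omega^\delta\setminus\{a,a^\ast\}$, one has $F_\varpi(a,b)\in\eta_b\mathbb R$, i.e. $\Pr_{i\eta_b}(F_\varpi(a,b))=0$.
   Context: Discrete domains: fix $\delta>0$. A discrete domain $\Omega^\delta$ is a bounded connected subset of the square lattice $\delta\mathbb Z^2$ given by a set of faces $\mathcal F(\Omega^\delta)$, vertices $\mathcal V(\Omega^\delta)$, interior edges and boundary half-edges (together $\mathcal E(\Omega^\delta)$), such that all four edges and vertices of each face in $\mathcal F(\Omega^\delta)$ belong to the domain, each vertex of the domain is incident to exactly four edges or half-edges of the domain, each vertex incident to an edge or half-edge of the domain belongs to $\mathcal V(\Omega^\delta)$, and at least one of the two faces incident to each interior edge belongs to $\mathcal F(\Omega^\delta)$. A boundary half-edge $e$ is the half of a lattice edge adjacent to a vertex of the domain whose other endpoint is not in the domain; $z_e$ denotes the midpoint of an interior edge $e$, or, for a boundary half-edge, its endpoint that is not a vertex; edges are identified with the points $z_e$. $\partial\Omega^\delta$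 is the set of boundary half-edges. A double cover is a graph $\widetilde\Omega^\delta$ with a two-to-one local graph isomorphism $\varpi:\widetilde\Omega^\delta\to\Omega^\delta$; for $z\in\widetilde\Omega^\delta$, $z^\ast\ne z$ denotes the other point with $\varpi(z^\ast)=\varpi(z)$. Double covers correspond to choosing, for each hole of $\Omega^\delta$, whether a loop surrounding it lifts to a closed loop or to a path between the two sheets (''$\varpi$ branches around'' the hole). Configurations: fix $x=\sqrt2-1$. For edges/half-edges $e_1,\dots,e_n$, $\mathrm{Conf}_{e_1,\dots,e_n}(\Omega^\delta)$ is the set of sets $S$ of edges and half-edges (halves of interior edges allowed) such that every vertex of $\Omega^\delta$ is incident to $0,2$ or $4$ elements of $S$, for each edge $e=e'\cup e''$ split into halves at most one of $e,e',e''$ is in $S$, and the set of half-edges in $S$ equals the set of those $e_j$ that appear an odd number of times in the list. $|S|$ is the number of elements of $S$. If $e_j$ are points of $\widetilde\Omega^\delta$, one uses $\varpi(e_j)$. Observable: a boundary half-edge $a$, oriented from its vertex to $z_a$ and viewed as a complex number, gets $\eta_a:=(ia/|a|)^{-1/2}$ (a fixed choice of sign). For $z=z_e$, $e\in\mathcal E(\widetilde\Omega^\delta)$, and $S\in\mathrm{Conf}_{a,z}(\Omega^\delta)$, decompose $S$ into loops and a simple lattice path $\gamma$ from $\varpi(a)$ to $\varpi(z)$ with no transversal crossings; $l(S)$ is the number of loops that do not lift to closed loops on $\widetilde\Omega^\delta$; $s(z,\gamma)=+1$ if $\gamma$ lifts to a path from $a$ to $z$, $-1$ if it lifts to a path from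 $a$ to $z^\ast$; $\mathrm{wind}(\gamma)$ is the total rotation angle of the tangent direction along $\gamma$. Set $W_\varpi(z,S)=e^{-\frac i2\mathrm{wind}(\gamma)}(-1)^{l(S)}s(z,\gamma)$ (independent of the decomposition) and $$F_\varpi(a,z):=i\eta_a\sum_{S\in\mathrm{Conf}_{a,z}(\Omega^\delta)}W_\varpi(z,S)x^{|S|}.$$ Corners: for a vertex $v$, its four corners are $v_k=v+e^{i\pi(2k+1)/4}\delta/(2\sqrt2)$, $k=0,1,2,3$, with $\eta_{v_k}:=e^{-i\pi(2k+1)/8}$; $\Upsilon(\widetilde\Omega^\delta)$ is the set of corners of the double cover. For a unit complex number $\eta$, $\Pr_\eta(F):=\mathrm{Re}(\bar\eta F)\eta$. Similarly $\eta_b$ for boundary half-edges $b$.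
   Formalization: Two conventions are corrected because (i) fails as written: corners use η_{v_k} = e^{-iπ(2k+3)/8} (the same rule as η_a) instead of e^{-iπ(2k+1)/8}, and in |S| each half-edge counts 1/2, which matters only for corners adjacent to a or a*. *)

(* Defs.v *)
(* Complex numbers are the algebraic complex numbers algC:
   every quantity in the statement (x = sqrt 2 - 1, eta's, exp(-i wind/2))
   is algebraic. *)
From HB Require Import structures.
From mathcomp Require Import all_boot all_order all_algebra all_field.
From Stdlib Require Import ClassicalEpsilon.
Set Implicit Arguments. Unset Strict Implicit. Unset Printing Implicit Defensive.
Import Order.TTheory GRing.Theory Num.Theory.
Local Open Scope ring_scope.

(* omega = exp(i pi/8), written with explicit radicals. *)
Definition omega : algC :=
  (sqrtC (2 + sqrtC 2) + 'i * sqrtC (2 - sqrtC 2)) / 2.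

Definition xcrit : algC := sqrtC 2 - 1.

Definition Pr (eta F : algC) : algC := 'Re (eta^* * F) * eta.

(* Directions: k : 'I_4 stands for the unit vector i^k (E, N, W, S). *)
Definition dE : 'I_4 := @Ordinal 4 0 isT.
Definition dN : 'I_4 := @Ordinal 4 1 isT.
Definition dW : 'I_4 := @Ordinal 4 2 isT.
Definition dS : 'I_4 := @Ordinal 4 3 isT.
Definition opp (k : 'I_4) : 'I_4 := ordS (ordS k).

(* eta of a boundary half-edge pointing (from its vertex) in direction i^k:
   (i * i^k)^(-1/2) = omega^(-2(k+1)) (a fixed choice of sign). *)
Definition eta_dir (k : 'I_4) : algC := omega ^ (- (2 * (val k + 1)%:Z)).
(* eta of the corner v_k = v + exp(i pi (2k+1)/4) delta/(2 sqrt 2).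
   NOTE: the context writes exp(-i pi (2k+1)/8);
   with eta_a = (i a/|a|)^(-1/2) this makes (i) false (checked numerically),
   the consistent normalisation is (i (v_k - v)/|v_k - v|)^(-1/2)
   = exp(-i pi (2k+3)/8), which we use. *)
Definition eta_corner (k : 'I_4) : algC := omega ^ (- (2 * (val k)%:Z + 3)).

Section Lattice.
Variables N M : nat.

(* Vertices of the lattice (a box, w.l.o.g. after translation; lattice
   spacing delta is irrelevant, only directions enter). *)
Definition vtx := ('I_N * 'I_M)%type.
(* A "piece": the half of the lattice edge at vertex v in direction k
   (the half adjacent to v). *)
Definition piece := (vtx * 'I_4)%type.

Definition nbr (v : vtx) (k : 'I_4) : option vtx :=
  match val k with
  | 0%N => omap (fun x' : 'I_N => (x', v.2)) (insub (val v.1).+1)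
  | 1%N => omap (fun y' : 'I_M => (v.1, y')) (insub (val v.2).+1)
  | 2%N => if val v.1 is x'.+1 then omap (fun x'' : 'I_N => (x'', v.2)) (insub x')
           else None
  | _ => if val v.2 is y'.+1 then omap (fun y'' : 'I_M => (v.1, y'')) (insub y')
         else None
  end.

Section Domain.
Variable V : {set vtx}.

Definition boundary (p : piece) : bool :=
  (p.1 \in V) && (if nbr p.1 p.2 is Some w then w \notin V else true).
Definition interior_half (p : piece) : bool :=
  (p.1 \in V) && (if nbr p.1 p.2 is Some w then w \in V else false).
Definition mate (p : piece) : piece :=
  if nbr p.1 p.2 is Some w then (w, opp p.2) else p.
(* base half of an edge: the one at the W resp. S endpoint *)
Definition base (p : piece) : bool := (val p.2 < 2)%N.

(* Edges of the domain are represented by a canonical piece: boundary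
   half-edges by themselves, interior edges by their base half. *)
Definition edge_rep (p : piece) : bool := boundary p || (interior_half p && base p).

(* faces are represented by their lower-left vertex *)
Definition face_ok (f : vtx) : bool :=
  match nbr f dE, nbr f dN with
  | Some fe, Some fn =>
      [&& f \in V, fe \in V, fn \in V & if nbr fe dN is Some g then g \in V else false]
  | _, _ => false
  end.

Definition inc_faces (p : piece) : seq vtx :=
  p.1 :: (if val p.2 == 0%N then (if nbr p.1 dS is Some w then [:: w] else [::])
          else (if nbr p.1 dW is Some w then [:: w] else [::])).

Definition adjV (v w : vtx) : bool :=
  [&& v \in V, w \in V & [exists k, nbr v k == Some w]].

(* Discrete domain given by vertex set V and face set Fc.  The edge set is
   forced by the axioms: every lattice edge between two vertices of V is an
   interior edge, every other lattice edge at a vertex of V gives a boundary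
   half-edge. *)
Definition discrete_domain (Fc : {set vtx}) : Prop :=
  [/\ V != set0,
      (forall f, f \in Fc -> face_ok f),
      (forall p, interior_half p -> base p -> has (fun f => f \in Fc) (inc_faces p))
    & (forall v w, v \in V -> w \in V -> connect adjV v w)].

(* Double covers, up to isomorphism: a Z/2 voltage sig on interior edges
   (stored on both halves); lifts of a vertex v are (v, s), s : bool, and the
   lift of edge (v,w) starting at (v,s) ends at (w, s (+) sig).  The boundary
   of each face of the domain lifts to a closed loop (branching only around
   holes). *)
Definition face_flat (sig : piece -> bool) (f : vtx) : bool :=
  match nbr f dE, nbr f dN with
  | Some fe, Some fn => ~~ (sig (f, dE) (+) sig (f, dN) (+) sig (fn, dE) (+) sig (fe, dN))
  | _, _ => true
  end.

Definition double_cover (Fc : {set vtx}) (sig : piece -> bool) : Prop :=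
  (forall p, interior_half p -> sig (mate p) = sig p) /\
  (forall f, f \in Fc -> face_flat sig f).

Variable sig : piece -> bool.

(* Points of E(cover): pairs (canonical piece, sheet).  The sheet of the
   midpoint of a lifted interior edge is the sheet of its base endpoint.
   liftp p s : the lifted edge/half-edge through the lift (v,s) of the vertex
   v of p. *)
Definition liftp (p : piece) (s : bool) : piece * bool :=
  if interior_half p && ~~ base p then (mate p, s (+) sig p) else (p, s).

(* ---- configurations (S represented by the set H of pieces it covers) ---- *)
Definition deg (H : {set piece}) (v : vtx) : nat := #|[set p in H | p.1 == v]|.
Definition lone (H : {set piece}) (p : piece) : bool :=
  (p \in H) && ~~ (interior_half p && (mate p \in H)).
Definition loneset (H : {set piece}) : {set piece} := [set p in H | lone H p].
Definition nfull (H : {set piece}) : nat := ((#|H| - #|loneset H|)./2)%N.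
Definition xweight (H : {set piece}) : algC :=
  xcrit ^+ nfull H * sqrtC xcrit ^+ #|loneset H|.

(* Conf_{a,z}: pa, pz canonical pieces of varpi(a), varpi(z) *)
Definition conf (pa pz : piece) (H : {set piece}) : bool :=
  [&& [forall p in H, p.1 \in V],
      [forall v, deg H v \in [:: 0; 2; 4]%N]
    & if pz == pa then loneset H == set0
      else if boundary pz then loneset H == [set pa; pz]
      else (loneset H == [set pa; pz]) || (loneset H == [set pa; mate pz])].

(* decomposition into loops and a path: a non-crossing pairing pr of the
   pieces of H at each vertex *)
Definition pairing (H : {set piece}) (pr : piece -> piece) : Prop :=
  forall p, p \in H ->
    [/\ pr p \in H, pr (pr p) = p, (pr p).1 = p.1, (pr p).2 != p.2
      & deg H p.1 = 4%N -> (pr p).2 != opp p.2].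

(* the path gamma: es = pieces through which gamma enters successive vertices *)
Definition path_ok (H : {set piece}) (pr : piece -> piece) (pa : piece)
    (es : seq piece) : Prop :=
  if es is e0 :: _ then
    [/\ e0 = pa, pa \in H,
        (forall j, (j.+1 < size es)%N ->
           ~~ lone H (pr (nth pa es j)) /\ nth pa es j.+1 = mate (pr (nth pa es j)))
      & lone H (pr (last pa es))]
  else pa \notin H.

(* turn when entering through e and leaving through x : +1 left, -1 right *)
Definition turn (e x : piece) : int :=
  match ((val x.2 + 6 - val e.2) %% 4)%N with
  | 1%N => 1 | 3%N => -1 | _ => 0 end.

(* wind(gamma) = (pi/2) * windcount *)
Definition windcount (pr : piece -> piece) (es : seq piece) : int :=
  \sum_(e <- es) turn e (pr e).

Definition lk (H : {set piece}) (pr : piece -> piece) (p q : piece) : bool :=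
  [&& p \in H, q \in H & (q == pr p) || (interior_half p && (q == mate p))].

Definition pathset (pr : piece -> piece) (es : seq piece) : {set piece} :=
  [set p | (p \in es) || (p \in map pr es)].

(* l(S): number of loops not lifting to closed loops *)
Definition nodd (H : {set piece}) (pr : piece -> piece) (es : seq piece) : nat :=
  #|[set C in [set [set q | connect (lk H pr) p q] | p in H :\: pathset pr es]
     | odd #|[set q in C | [&& base q, interior_half q & sig q]]| ]|.

Definition endlift (pr : piece -> piece) (a : piece * bool) (es : seq piece)
   : piece * bool :=
  if es is _ :: _ then
    liftp (pr (last a.1 es))
          (a.2 (+) odd (count (fun e => sig (pr e)) (take (size es).-1 es)))
  else a.

Definition dec_weight (H : {set piece}) (pr : piece -> piece) (a z : piece * bool)
   (es : seq piece) : algC :=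
  omega ^ (- (2 * windcount pr es)) * (-1) ^+ nodd H pr es
  * (if endlift pr a es == z then 1 else -1).

(* W_varpi(z,S), computed from any valid decomposition *)
Definition Wt (a z : piece * bool) (H : {set piece}) : algC :=
  epsilon (inhabits 0) (fun w => exists pr es,
     [/\ pairing H pr, path_ok H pr a.1 es & w = dec_weight H pr a z es]).

Definition Fobs (a z : piece * bool) : algC :=
  'i * eta_dir a.1.2 *
  \sum_(H : {set piece} | conf a.1 z.1 H) Wt a z H * xweight H.

End Domain.
End Lattice.

(* Main.v *)
Require Import Defs.
From HB Require Import structures.
From mathcomp Require Import all_boot all_order all_algebra all_field.
From mathcomp Require Import zify ring.
From Stdlib Require Import Btauto ClassicalEpsilon.
Set Implicit Arguments. Unset Strict Implicit. Unset Printing Implicit Defensive.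
Import Order.TTheory GRing.Theory Num.Theory.

(** The weight of a configuration has a closed form that does not mention its
    decomposition.  Order the pieces (half-edges) vertex by vertex, and
    counterclockwise within a vertex, and view a full edge as a chord joining
    its two halves.  Adding up, along the path of a decomposition, the local
    relation between a turn and the order of the two pieces involved gives the
    winding modulo 4 pi in terms of the final direction and of the parity of
    the number of crossings between the chords, a chord joining the two ends
    of the path included.  The number of crossings between two families of chords
    modulo 2 only depends on the two sets of endpoints; since the pairing at
    the vertices does not cross, the loops of the decomposition contribute
    nothing, provided that the number of edges plus the number of
    crossings is even for a union of loops.  This last fact, the only place
    where planarity enters, holds because that parity does not change when the
    boundary of a face is added.  Likewise (-1)^l s is the total voltage of the
    configuration, whatever the decomposition.

    With the closed form, toggling the two half-edges that form the corner is a
    bijection from Conf(a, z') to Conf(a, z''), under which the projections on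
    the line of eta_c agree term by term; the factor x = sqrt 2 - 1 enters
    through Re (omega^3) = x Re omega. *)

(** * Sums modulo 2 *)

Section XorSum.
Variable T : finType.
Implicit Types (A B : {set T}) (f g : T -> bool).

Definition xsum A f := \big[addb/false]_(x in A) f x.
Definition symdiff A B := [set x | (x \in A) (+) (x \in B)].

Lemma in_symdiff A B x : (x \in symdiff A B) = (x \in A) (+) (x \in B).
Proof. by rewrite inE. Qed.

Lemma xsumE A f : xsum A f = \big[addb/false]_x ((x \in A) && f x).
Proof. by rewrite /xsum big_mkcond; apply: eq_bigr => x _; case: (x \in A). Qed.

Lemma eq_xsum A f g : {in A, f =1 g} -> xsum A f = xsum A g.
Proof. by move=> h; apply: eq_bigr. Qed.

Lemma xsumD A f g : xsum A (fun x => f x (+) g x) = xsum A f (+) xsum A g.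
Proof. by rewrite /xsum big_split. Qed.

Lemma xsum_symdiff A B f : xsum (symdiff A B) f = xsum A f (+) xsum B f.
Proof.
rewrite !xsumE -big_split; apply: eq_bigr => x _ /=.
by rewrite in_symdiff; case: (x \in A); case: (x \in B); case: (f x).
Qed.

Lemma xsumU1 x A f : x \notin A -> xsum (x |: A) f = f x (+) xsum A f.
Proof. by move=> h; rewrite /xsum big_setU1. Qed.

Lemma xsumU A B f : [disjoint A & B] -> xsum (A :|: B) f = xsum A f (+) xsum B f.
Proof. by move=> d; rewrite /xsum -bigU //; apply: eq_bigl => x; rewrite !inE. Qed.

Lemma xsum1 x f : xsum [set x] f = f x.
Proof. by rewrite /xsum big_set1. Qed.

Lemma xsum0 f : xsum set0 f = false.
Proof. by rewrite /xsum big_set0. Qed.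

Lemma xsumM A b f : xsum A (fun x => b && f x) = b && xsum A f.
Proof. by rewrite /xsum; case: b => //=; rewrite big1_eq. Qed.

Lemma xsum_pred1 A y : xsum A (pred1 y) = (y \in A).
Proof.
rewrite xsumE (bigD1 y) //= eqxx andbT big1 ?addbF // => x /negbTE /= ->.
by rewrite andbF.
Qed.

Lemma odd_card A f : odd #|[set x in A | f x]| = xsum A f.
Proof.
rewrite xsumE -sum1_card (big_morph odd oddD (erefl _)) big_mkcond.
by apply: eq_bigr => x _; rewrite inE; case: (x \in A); case: (f x).
Qed.

Lemma xsum_invol A f (i : T -> T) :
  {in A, forall x, i x \in A /\ i x != x} -> {in A, involutive i} ->
  {in A, forall x, f (i x) = f x} -> xsum A f = false.
Proof.
move=> hA hi hf.
have rkN x : x \in A -> (enum_rank (i x) < enum_rank x)%N = ~~ (enum_rank x < enum_rank (i x))%N.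
  move=> xA; have /negbTE := (hA x xA).2.
  by rewrite -(inj_eq enum_rank_inj) -val_eqE /=; case: ltngtP.
rewrite /xsum (bigID (fun x => enum_rank x < enum_rank (i x))%N) /=.
rewrite [X in _ (+) X](reindex_onto i i) /=; last first.
  by move=> x /andP[xA _]; apply: hi.
set u := \big[_/_]_(_ | _) _; set v := \big[_/_]_(_ | _) _.
suff -> : v = u by rewrite addbb.
rewrite /u /v; apply: eq_big => [x|x /andP[/andP[ixA h] /eqP ix]].
  apply/idP/idP => [/andP[/andP[ixA h] /eqP ix]|/andP[xA h]].
    have [xA _] := hA _ ixA; rewrite ix in xA.
    by rewrite xA /=; rewrite -rkN // in h; rewrite ix in h.
  have [ixA _] := hA _ xA.
  by rewrite ixA hi // eqxx andbT /= -leqNgt ltnW.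
by have [xA _] := hA _ ixA; rewrite ix in xA; rewrite hf.
Qed.

End XorSum.

(* The quadratic form over F_2 with value 1 on singletons and polar form [c];
   the enumeration order only serves to list unordered pairs once. *)
Section Quad.
Variables (T : finType) (c : rel T).

Definition quad_form (B : {set T}) :=
  xsum B (fun e => ~~ xsum [set f in B | (enum_rank f < enum_rank e)%N] (c e)).

Lemma quad_formU1 e (B : {set T}) : e \notin B -> {in B, forall f, c f e = c e f} ->
  quad_form (e |: B) = quad_form B (+) ~~ xsum B (c e).
Proof.
move=> eB hc; rewrite /quad_form xsumU1 //.
have -> : xsum [set f in e |: B | (enum_rank f < enum_rank e)%N] (c e) =
   xsum [set f in B | (enum_rank f < enum_rank e)%N] (c e).
  congr (xsum _ _); apply/setP => f; rewrite !inE.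
  by case: eqP => [->|//] /=; rewrite ltnn (negbTE eB).
have -> : xsum B (fun x => ~~ xsum [set f in e |: B | (enum_rank f < enum_rank x)%N] (c x)) =
   xsum B (fun x => ~~ xsum [set f in B | (enum_rank f < enum_rank x)%N] (c x) (+)
            ((enum_rank e < enum_rank x)%N && c e x)).
  apply: eq_xsum => x xB.
  case: ltnP => [lt|le] /=.
    have -> : [set f in e |: B | (enum_rank f < enum_rank x)%N] =
       e |: [set f in B | (enum_rank f < enum_rank x)%N].
      by apply/setP => f; rewrite !inE; case: eqP => //= ->; rewrite lt.
    rewrite xsumU1 ?inE ?(negbTE eB) // hc //.
    by case: (c e x); case: (xsum _ _).
  rewrite addbF; congr (~~ xsum _ _); apply/setP => f; rewrite !inE.
  by case: eqP => //= ->; rewrite ltnNge le (negbTE eB).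
rewrite xsumD.
have -> : xsum B (c e) = xsum [set f in B | (enum_rank f < enum_rank e)%N] (c e)
   (+) xsum B (fun x => (enum_rank e < enum_rank x)%N && c e x).
  have -> : xsum [set f in B | (enum_rank f < enum_rank e)%N] (c e) =
     xsum B (fun x => (enum_rank x < enum_rank e)%N && c e x).
    rewrite !xsumE; apply: eq_bigr => x _; rewrite inE.
    by case: (x \in B).
  rewrite -xsumD; apply: eq_xsum => x xB.
  have /negbTE : enum_rank x != enum_rank e.
    by rewrite (inj_eq enum_rank_inj); apply: contra eB => /eqP <-.
  rewrite -val_eqE /=.
  by case: ltngtP => //= _ _; rewrite ?addbF.
set u := xsum _ _; set v := xsum _ _; set w := xsum _ _.
by case: u v w => [] [] [].
Qed.

Lemma quad_form0 : quad_form set0 = false.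
Proof. by rewrite /quad_form xsum0. Qed.

Lemma quad_formU (A B : {set T}) : [disjoint A & B] -> {in A :|: B &, symmetric c} ->
  quad_form (A :|: B) = quad_form A (+) quad_form B (+) xsum A (fun e => xsum B (c e)).
Proof.
have [n] := ubnP #|A|; elim: n A => // n IH A ltAn dAB hc.
have [->|[e eA]] := set_0Vmem A; first by rewrite set0U xsum0 quad_form0 addbF.
set A' := A :\ e.
have eA' : e \notin A' by rewrite !inE eqxx.
have eB : e \notin B by apply/negP => eB; move/pred0P: dAB => /(_ e) /=; rewrite eA eB.
have defA : A = e |: A' by rewrite setD1K.
have sA'A : A' \subset A by apply: subD1set.
have dA'B : [disjoint A' & B] by apply: disjointWl dAB.
have hc' : {in A' :|: B &, symmetric c}.
  by move=> x y xI yI; apply: hc; exact: (subsetP (setSU B sA'A)).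
have hce (D : {set T}) : D \subset A :|: B -> {in D, forall f, c f e = c e f}.
  by move=> sD f fD; apply: hc; [exact: (subsetP sD f fD) | rewrite !inE eA].
rewrite defA -setUA quad_formU1; first last.
- by apply: hce; rewrite setSU.
- by rewrite !inE eqxx (negbTE eB).
rewrite quad_formU1 //; last by apply: hce; apply: subset_trans sA'A (subsetUl _ _).
rewrite IH //; last by rewrite -ltnS (leq_trans _ ltAn) // (cardsD1 e A) eA.
rewrite [xsum (e |: A') _]xsumU1 //.
have -> : xsum (A' :|: B) (c e) = xsum A' (c e) (+) xsum B (c e).
  exact: xsumU.
set u1 := quad_form A'; set u2 := quad_form B; set u3 := xsum A' (c e); set u4 := xsum B (c e).
by set u5 := xsum A' _; move: u1 u2 u3 u4 u5 => [] [] [] [] [].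
Qed.

End Quad.

(** * The order on pieces *)

Section Box.
Variables N M : nat.
Implicit Types (v w u : vtx N M) (k : 'I_4) (p q x y : piece N M).

Lemma nbrP v w k : reflect
  ((w.1 + (val k == 2) = v.1 + (val k == 0))%N /\
   (w.2 + (val k == 3) = v.2 + (val k == 1))%N) (nbr v k == Some w).
Proof.
have eqv (a : 'I_N) (b : 'I_M) : (Some (a, b) == Some w) = (a == w.1 :> nat) && (b == w.2 :> nat).
  by case: w => c d.
case: v k => a b [[|[|[|[|k]]]] lk] //; rewrite /nbr /=.
- case: insubP => /= [c lc ec|nlc].
    rewrite eqv ec; apply: (iffP andP) => /=; case: w {eqv} => c' d' /=; lia.
  by apply: (iffP eqP) => // -[]; have := ltn_ord w.1; lia.
- case: insubP => /= [c lc ec|nlc].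
    rewrite eqv ec; apply: (iffP andP) => /=; case: w {eqv} => c' d' /=; lia.
  by apply: (iffP eqP) => // -[]; have := ltn_ord w.2; lia.
- case: a => [[|a'] la] /=; first by apply: (iffP eqP) => // -[]; lia.
  case: insubP => /= [c lc ec|nlc]; last by exfalso; lia.
  by rewrite eqv ec; apply: (iffP andP) => /=; case: w {eqv} => c' d' /=; lia.
case: b => [[|b'] lb] /=; first by apply: (iffP eqP) => // -[]; lia.
case: insubP => /= [c lc ec|nlc]; last by exfalso; lia.
by rewrite eqv ec; apply: (iffP andP) => /=; case: w {eqv} => c' d' /=; lia.
Qed.

Lemma val_opp k : val (Defs.opp k) = ((k + 2) %% 4)%N.
Proof. by case: k => [[|[|[|[|k]]]] lk]. Qed.

Lemma oppK : involutive Defs.opp.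
Proof. by case=> [[|[|[|[|k]]]] lk] //; apply: val_inj. Qed.

Lemma nbr_opp v w k : nbr v k = Some w -> nbr w (Defs.opp k) = Some v.
Proof.
move/eqP/nbrP => h; apply/eqP/nbrP; move: h; rewrite val_opp.
by case: k => [[|[|[|[|k]]]] lk] //=; lia.
Qed.

Lemma mateK : involutive (@mate N M).
Proof.
move=> [v k]; rewrite /mate /=; case e: (nbr v k) => [w|] /=; last by rewrite e.
by rewrite (nbr_opp e) oppK.
Qed.

Lemma mate_inj : injective (@mate N M).
Proof. exact: inv_inj mateK. Qed.

Definition vtx_rank v : nat := (v.2 * N + v.1)%N.
Definition piece_rank p : nat := (4 * vtx_rank p.1 + p.2)%N.
Definition prec x y : bool := (piece_rank x < piece_rank y)%N.

Lemma vtx_rank_inj : injective vtx_rank.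
Proof.
move=> [a b] [c d]; rewrite /vtx_rank /= => h.
have la := ltn_ord a; have lc := ltn_ord c.
have hb : (b = d :> nat).
  have := congr1 (divn^~ N) h; rewrite /= !divnMDl; try lia.
  by rewrite !divn_small // !addn0.
have ha : (a = c :> nat) by move: h; rewrite hb; lia.
by congr (_, _); apply: val_inj.
Qed.

Lemma piece_rank_inj : injective piece_rank.
Proof.
move=> [v k] [w l]; rewrite /piece_rank /= => h.
have := ltn_ord k; have := ltn_ord l => lk ll.
have hv : vtx_rank v = vtx_rank w by lia.
by rewrite (vtx_rank_inj hv); congr (_, _); apply: val_inj => /=; lia.
Qed.

Lemma precC x y : x != y -> prec y x = ~~ prec x y.
Proof.
by rewrite -(inj_eq piece_rank_inj) /prec; case: ltngtP.
Qed.

Lemma precxx x : prec x x = false.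
Proof. by rewrite /prec ltnn. Qed.

Lemma prec_vtx x y : x.1 != y.1 -> prec x y = (vtx_rank x.1 < vtx_rank y.1)%N.
Proof.
rewrite -(inj_eq vtx_rank_inj) /prec /piece_rank; have := ltn_ord x.2; have := ltn_ord y.2; lia.
Qed.

Lemma prec_dir x y : x.1 = y.1 -> prec x y = (x.2 < y.2)%N.
Proof. by rewrite /prec /piece_rank => ->; rewrite ltn_add2l. Qed.

Lemma nbr_neq v w k : nbr v k = Some w -> w != v.
Proof.
by move/eqP/nbrP => h; apply/eqP => e; move: h; rewrite e; case: k => [[|[|[|[|k]]]] lk] //=; lia.
Qed.

Lemma mateE p : mate p != p -> nbr p.1 p.2 = Some (mate p).1 /\ (mate p).2 = Defs.opp p.2.
Proof. by rewrite /mate; case: nbr => [w|]; rewrite ?eqxx. Qed.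

Lemma mate_vtx p : mate p != p -> (mate p).1 != p.1.
Proof. by case/mateE => h _; apply: nbr_neq h. Qed.

Lemma base_mate p : mate p != p -> base (mate p) = ~~ base p.
Proof.
case/mateE => _; rewrite /base => ->; rewrite val_opp.
by case: p => v [[|[|[|[|k]]]] lk].
Qed.

Lemma prec_mate p : mate p != p -> prec p (mate p) = base p.
Proof.
move=> h; have hv := mate_vtx h; rewrite prec_vtx 1?eq_sym //.
have [/eqP/nbrP] := mateE h; rewrite /vtx_rank /base.
case: (mate p).1 hv => a b; case: p {h} => [[c d] [[|[|[|[|k]]]] lk]] //= _ [h1 h2] _.
- by have -> : (b = d :> nat)%N by [lia]; lia.
- have -> : (b = d + 1 :> nat)%N by lia.
  by have := ltn_ord c; rewrite mulnDl; lia.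
- by have -> : (b = d :> nat)%N by [lia]; lia.
have -> : (d = b + 1 :> nat)%N by lia.
by have := ltn_ord a; rewrite mulnDl; lia.
Qed.

End Box.

(** * Crossings of chords *)

Section Crossing.
Variables N M : nat.
Implicit Types (v w u : vtx N M) (k l : 'I_4) (p q x y e f : piece N M) (H L : {set piece N M}).

(* For two edges without common half, the parity of the number of times their
   chords cross: it only depends on which halves precede which. *)
Definition crossing e f : bool :=
  prec e f (+) prec e (mate f) (+) prec (mate e) f (+) prec (mate e) (mate f).

Definition paired H := [set x in H | (mate x \in H) && (mate x != x)].
Definition paired_base H := [set x in paired H | base x].
Definition cross_parity H := quad_form crossing (paired_base H).

Lemma mate_eq p q : (mate p == q) = (p == mate q).
Proof. by rewrite -[in RHS](inj_eq (@mate_inj N M)) mateK. Qed.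

Lemma in_paired H x : (x \in paired H) = [&& x \in H, mate x \in H & mate x != x].
Proof. by rewrite inE. Qed.

Lemma in_paired_base H x : (x \in paired_base H) = [&& x \in H, mate x \in H, mate x != x & base x].
Proof. by rewrite inE in_paired -!andbA. Qed.

Lemma xsum_base H g : xsum (paired_base H) (fun x => g x (+) g (mate x)) = xsum (paired H) g.
Proof.
rewrite xsumD; have -> : xsum (paired_base H) (fun x => g (mate x)) = xsum [set x in paired H | ~~ base x] g.
  rewrite !xsumE (reindex_inj (@mate_inj N M)); apply: eq_bigr => x _.
  rewrite in_set !in_paired_base in_paired mateK eq_sym; congr (_ && _).
  case: (boolP (mate x == x)) => h; rewrite ?andbF //= !andbT.
  by rewrite base_mate // andbA (andbC (x \in H)).
rewrite -xsumU; last first.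
  by apply/pred0P => x /=; rewrite !inE; case: (base x); rewrite ?andbF.
congr (xsum _ _); apply/setP => x; rewrite !inE.
by case: (base x); rewrite ?andbF ?andbT ?orbF.
Qed.

Lemma crossing_sym e f : base e -> base f -> mate e != e -> mate f != f ->
    crossing f e = crossing e f.
Proof.
move=> be bf me mf; have [->//|nef] := eqVneq e f.
have n1 : e != mate f by apply: contraTneq be => ->; rewrite base_mate // negbK.
have n2 : mate e != f by apply: contraTneq bf => <-; rewrite base_mate // negbK.
have n3 : mate e != mate f by rewrite (inj_eq (@mate_inj N M)).
rewrite /crossing (precC nef) (precC n1) (precC n2) (precC n3).
by do 4!case: (prec _ _).
Qed.

Lemma crossing_mate e f : crossing (mate e) f = crossing e f.
Proof. by rewrite /crossing mateK; do 4!case: (prec _ _). Qed.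

Lemma xsum_crossing e H : xsum (paired_base H) (crossing e) = xsum (paired H) (fun x => prec e x (+) prec (mate e) x).
Proof.
rewrite -xsum_base; apply: eq_xsum => x _; rewrite /crossing.
by do 4!case: (prec _ _).
Qed.

Definition base_half q := if base q then q else mate q.

Lemma paired_base_add q H : q \notin H -> mate q \in H ->
  base_half q \notin paired_base H /\ paired_base (q |: H) = base_half q |: paired_base H.
Proof.
move=> qH mqH; have mq : mate q != q by apply: contraNneq qH => <-.
split.
  by rewrite in_paired_base /base_half; case: ifP => _; rewrite ?mateK (negbTE qH) ?andbF.
apply/setP => x; rewrite !(in_paired_base, in_setU1) /base_half.
have [->|nxq] := eqVneq x q.
  by rewrite mqH mq (negbTE qH) /=; case: (base q); rewrite ?eqxx ?(eq_sym q (mate q)) ?(negbTE mq).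
have [->|nmx] := eqVneq x (mate q).
  rewrite mateK mqH (negbTE qH) base_mate // (eq_sym q) mq /=.
  by case: (base q); rewrite ?eqxx ?(negbTE mq).
rewrite -[mate x == q](inj_eq (@mate_inj N M)) mateK (negbTE nmx) /=.
by case: (base q); rewrite ?(negbTE nxq) ?(negbTE nmx).
Qed.

Lemma cross_parity_add q H : q \notin H -> mate q \in H ->
  cross_parity (q |: H) = cross_parity H (+) ~~ xsum (paired H) (fun x => prec q x (+) prec (mate q) x).
Proof.
move=> qH mqH; have [rF defF] := paired_base_add qH mqH.
have mq : mate q != q by apply: contraNneq qH => <-.
have mr : mate (base_half q) != base_half q by rewrite /base_half; case: ifP => _ //; rewrite mateK eq_sym.
have br : base (base_half q) by rewrite /base_half; case: ifP => // h; rewrite base_mate ?h.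
rewrite /cross_parity defF quad_formU1 //; last first.
  by move=> f; rewrite in_paired_base => /and4P[_ _ mf bf]; apply: crossing_sym.
rewrite -xsum_crossing; congr (_ (+) ~~ _); apply: eq_xsum => x _.
by rewrite /base_half; case: ifP => _ //; rewrite crossing_mate.
Qed.

Lemma paired_lone q H : q \notin H -> mate q \notin H -> paired (q |: H) = paired H.
Proof.
move=> qH mqH; apply/setP => x; rewrite !(in_paired, in_setU1).
have [->|nxq] := eqVneq x q; last first.
  by have [e|//] := eqVneq (mate x) q; rewrite -(mateK x) e (negbTE mqH).
by rewrite (negbTE mqH) (negbTE qH) /= orbF; case: (mate q == q).
Qed.

Lemma cross_parity_lone q H : q \notin H -> mate q \notin H ->
    cross_parity (q |: H) = cross_parity H.
Proof. by move=> h1 h2; rewrite /cross_parity /paired_base paired_lone. Qed.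

Lemma cross_parity_toggle q L : paired L = L -> mate q != q ->
  let L' := symdiff L [set q; mate q] in
  paired L' = L' /\
  cross_parity L' = cross_parity L (+) ~~ (q \in L) (+) xsum L (fun x => prec q x (+) prec (mate q) x).
Proof.
move=> FL mq L'.
have mL x : (mate x \in L) = (x \in L).
  by rewrite -[in RHS]FL -[in LHS]FL !in_paired mateK eq_sym; case: (x \in L); rewrite /= ?andbF.
have mL' x : (mate x \in L') = (x \in L').
  rewrite !in_symdiff mL; congr (_ (+) _); rewrite !inE.
  by rewrite (inj_eq (@mate_inj N M)) mate_eq orbC.
have pL x : x \in L -> mate x != x by rewrite -{1}FL in_paired => /and3P[].
have FL' : paired L' = L'.
  apply/setP => x; rewrite in_paired mL'; case: (boolP (x \in L')) => //=.
  rewrite in_symdiff; case: (boolP (x \in L)) => [/pL //|_] /=.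
  by rewrite !inE => /orP[] /eqP ->; rewrite ?mateK // eq_sym.
split=> //; case: (boolP (q \in L)) => qL.
  have mqL : mate q \in L by rewrite mL.
  have defL : L = q |: (mate q |: L').
    apply/setP => x; rewrite !(in_symdiff, inE).
    have [->|_] := eqVneq x q; first by rewrite qL.
    by have [->|_] := eqVneq x (mate q); rewrite ?mqL // addbF.
  have qL' : q \notin L' by rewrite !(in_symdiff, inE) qL eqxx.
  have mqL' : mate q \notin L' by rewrite mL'.
  have qU : q \notin mate q |: L' by rewrite in_setU1 negb_or eq_sym mq.
  have mqU : mate q \in mate q |: L' by rewrite in_setU1 eqxx.
  rewrite [in RHS]defL cross_parity_add // cross_parity_lone ?mateK // paired_lone ?mateK // FL'.
  rewrite !xsumU1 // !precxx (@precC _ _ q (mate q)) 1?eq_sym //.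
  by case: (cross_parity L') (prec q _) (xsum L' _) => [] [] [].
have mqL : mate q \notin L by rewrite mL.
have defL : L' = mate q |: (q |: L).
  apply/setP => x; rewrite !(in_symdiff, inE).
  have [->|_] := eqVneq x q; first by rewrite (negbTE qL) orbT.
  by have [->|_] := eqVneq x (mate q); rewrite ?(negbTE mqL) // addbF.
rewrite [in LHS]defL cross_parity_add ?mateK ?in_setU1 ?eqxx ?negb_or ?mq //.
rewrite cross_parity_lone // paired_lone // FL.
have -> : xsum L (fun x => prec (mate q) x (+) prec q x) = xsum L (fun x => prec q x (+) prec (mate q) x).
  by apply: eq_xsum => x _; rewrite addbC.
by case: (cross_parity L) (xsum L _) => [] [].
Qed.

Lemma prec_pair u k l x : (k <= l)%N ->
  prec (u, k) x (+) prec (u, l) x = (x.1 == u) && (k < x.2 <= l)%N.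
Proof.
move=> kl; have [e|n] := eqVneq x.1 u.
  rewrite !prec_dir //= ltnNge; lia.
by rewrite !prec_vtx 1?eq_sym //= addbb.
Qed.

Definition even_deg H := forall v, xsum H (fun x => x.1 == v) = false.

Lemma cross_parity_face L v u1 u3 : paired L = L -> even_deg L ->
  nbr v dE = Some u1 -> nbr v dN = Some u3 ->
  exists u2, [/\ nbr u1 dN = Some u2, nbr u3 dE = Some u2 &
  let L' := symdiff (symdiff (symdiff (symdiff L [set (v, dE); (u1, dW)]) [set (v, dN); (u3, dS)])
    [set (u1, dN); (u2, dS)]) [set (u3, dE); (u2, dW)] in
  [/\ paired L' = L', even_deg L' & cross_parity L' = cross_parity L]].
Proof.
move=> FL eL n1 n3.
move/eqP/nbrP: (n1) => /= [a1 b1]; move/eqP/nbrP: (n3) => /= [a3 b3].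
pose u2 : vtx N M := (u1.1, u3.2).
have n12 : nbr u1 dN = Some u2 by apply/eqP/nbrP => /=; lia.
have n32 : nbr u3 dE = Some u2 by apply/eqP/nbrP => /=; lia.
exists u2; split=> //; set L' := symdiff _ [set _; (u2, dW)].
have r1 : vtx_rank u1 = (vtx_rank v).+1 by rewrite /vtx_rank; nia.
have r3 : vtx_rank u3 = (vtx_rank v + N)%N by rewrite /vtx_rank; nia.
have r2 : vtx_rank u2 = (vtx_rank v + N).+1 by rewrite /vtx_rank /u2 /=; nia.
have N2 : (2 <= N)%N by have := ltn_ord u1.1; lia.
have m1 : mate (v, dE) = (u1, dW) by rewrite /mate /= n1; congr (_, _); apply: val_inj.
have m2 : mate (v, dN) = (u3, dS) by rewrite /mate /= n3; congr (_, _); apply: val_inj.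
have m3 : mate (u1, dN) = (u2, dS) by rewrite /mate /= n12; congr (_, _); apply: val_inj.
have m4 : mate (u3, dE) = (u2, dW) by rewrite /mate /= n32; congr (_, _); apply: val_inj.
have lt01 : (vtx_rank v < vtx_rank u1)%N by rewrite r1.
have lt13 : (vtx_rank u1 < vtx_rank u3)%N by rewrite r1 r3 -addn1 ltn_add2l.
have lt32 : (vtx_rank u3 < vtx_rank u2)%N by rewrite r3 r2.
have lt03 := ltn_trans lt01 lt13; have lt12 := ltn_trans lt13 lt32.
have lt02 := ltn_trans lt01 lt12.
have V u w : (vtx_rank u < vtx_rank w)%N -> ((u == w) = false) * ((w == u) = false).
  by move=> h; split; apply/eqP => e; move: h; rewrite e ltnn.
have vE := (V _ _ lt01, V _ _ lt13, V _ _ lt32, V _ _ lt03, V _ _ lt12, V _ _ lt02).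
have S u w : (vtx_rank u < vtx_rank w)%N ->
    (forall k l, prec (u, k) (w, l) = true) * (forall k l, prec (w, k) (u, l) = false).
  move=> h; have [h1 h2] := V _ _ h; split=> k l; rewrite prec_vtx /= ?h1 ?h2 //.
  by rewrite ltnNge ltnW.
have sE := (S _ _ lt01, S _ _ lt13, S _ _ lt32, S _ _ lt03, S _ _ lt12, S _ _ lt02).
have [F1 Q1] := @cross_parity_toggle (v, dE) L FL ltac:(by rewrite m1 xpair_eqE vE).
rewrite m1 in F1 Q1; set L1 := symdiff L _ in F1 Q1.
have [F2 Q2] := @cross_parity_toggle (v, dN) L1 F1 ltac:(by rewrite m2 xpair_eqE vE).
rewrite m2 in F2 Q2; set L2 := symdiff L1 _ in F2 Q2.
have [F3 Q3] := @cross_parity_toggle (u1, dN) L2 F2 ltac:(by rewrite m3 xpair_eqE vE).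
rewrite m3 in F3 Q3; set L3 := symdiff L2 _ in F3 Q3.
have [F4 Q4] := @cross_parity_toggle (u3, dE) L3 F3 ltac:(by rewrite m4 xpair_eqE vE).
rewrite m4 -/L' in F4 Q4.
have e1 g : xsum [set (v, dE); (u1, dW)] g = g (v, dE) (+) g (u1, dW).
  by rewrite xsumU1 ?xsum1 // inE xpair_eqE vE.
have e2 g : xsum [set (v, dN); (u3, dS)] g = g (v, dN) (+) g (u3, dS).
  by rewrite xsumU1 ?xsum1 // inE xpair_eqE vE.
have e3 g : xsum [set (u1, dN); (u2, dS)] g = g (u1, dN) (+) g (u2, dS).
  by rewrite xsumU1 ?xsum1 // inE xpair_eqE vE.
have e4 g : xsum [set (u3, dE); (u2, dW)] g = g (u3, dE) (+) g (u2, dW).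
  by rewrite xsumU1 ?xsum1 // inE xpair_eqE vE.
split=> //.
  move=> w; rewrite /L' /L3 /L2 /L1 !xsum_symdiff eL e1 e2 e3 e4 /=.
  by case: (v == w); case: (u1 == w); case: (u2 == w); case: (u3 == w).
have key : xsum L (fun x => prec (v, dE) x (+) prec (u1, dW) x) (+)
  xsum L (fun x => prec (v, dN) x (+) prec (u3, dS) x) (+)
  xsum L (fun x => prec (u1, dN) x (+) prec (u2, dS) x) (+)
  xsum L (fun x => prec (u3, dE) x (+) prec (u2, dW) x) =
  ((v, dN) \in L) (+) ((u1, dW) \in L) (+) ((u2, dS) \in L) (+) ((u3, dE) \in L).
  rewrite -!(xsum_pred1 L) -[RHS]addbF -(eL u3) -!xsumD; apply: eq_xsum => -[w d] _.
  have A1 := @prec_pair v dE dN (w, d) isT; have A2 := @prec_pair u1 dN dW (w, d) isT.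
  have A3 := @prec_pair u2 dW dS (w, d) isT; have A4 := @prec_pair u3 dE dS (w, d) isT.
  transitivity ((prec (v, dE) (w, d) (+) prec (v, dN) (w, d)) (+)
    (prec (u1, dN) (w, d) (+) prec (u1, dW) (w, d)) (+)
    (prec (u2, dW) (w, d) (+) prec (u2, dS) (w, d)) (+)
    (prec (u3, dE) (w, d) (+) prec (u3, dS) (w, d))).
    by do 8!case: (prec _ _).
  rewrite A1 A2 A3 A4 /= !xpair_eqE.
  case: (w == v); case: (w == u1); case: (w == u2); case: (w == u3);
    by case: d {A1 A2 A3 A4} => [[|[|[|[|d]]]] ld].
have mL p : (mate p \in L) = (p \in L).
  by rewrite -[in RHS]FL -[in LHS]FL !in_paired mateK eq_sym; case: (p \in L); rewrite /= ?andbF.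
have M1 := mL (v, dE); have M3 := mL (u1, dN); rewrite m1 in M1; rewrite m3 in M3.
rewrite Q4 Q3 Q2 Q1 /L3 /L2 /L1 !in_symdiff !xsum_symdiff !e1 !e2 !e3 !in_set2 !xpair_eqE !vE /= !sE.
rewrite !prec_dir //=.
move: key; rewrite M1 -M3.
have -> : dN == dE = false by []. have -> : dN == dW = false by [].
have -> : dE == dS = false by []. rewrite !andbF.
set z1 := xsum L _; set z2 := xsum L _; set z3 := xsum L _; set z4 := xsum L _.
move: z1 z2 z3 z4 (cross_parity L) ((v, dN) \in L) ((v, dE) \in L) ((u2, dS) \in L) ((u3, dE) \in L).
by do 9!case.
Qed.
End Crossing.

Section Planar.
Variables N M : nat.
Implicit Types (v w u : vtx N M) (k l : 'I_4) (p q x y e f : piece N M) (H L : {set piece N M}).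

Lemma vtx_rank_lt v : (vtx_rank v < N * M)%N.
Proof. by rewrite /vtx_rank; have := ltn_ord v.1; have := ltn_ord v.2; nia. Qed.

Lemma vtx_rank_mate p : mate p != p -> (vtx_rank p.1 < vtx_rank (mate p).1)%N = base p.
Proof. by move=> h; rewrite -prec_mate // prec_vtx // eq_sym mate_vtx. Qed.

Lemma baseE p : base p = (p.2 == dE) || (p.2 == dN).
Proof. by case: p => v [[|[|[|[|k]]]] lk]. Qed.

(* Adding the boundary of the face at the lowest vertex of [L] frees this vertex
   of pieces, hence the induction. *)
Lemma cross_parity_even L : paired L = L -> even_deg L -> cross_parity L = false.
Proof.
suff H n r L' : (N * M - r <= n)%N -> (forall x, x \in L' -> r <= vtx_rank x.1)%N ->
    paired L' = L' -> even_deg L' -> cross_parity L' = false.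
  by apply: (H _ 0%N) (leqnn _) _.
elim: n r L' => [|n IH] r {}L hr hL FL eL.
  have -> : L = set0.
    apply/setP => x; rewrite inE; apply/negP => xL.
    have hr' : (N * M <= r)%N by rewrite -subn_eq0 -leqn0.
    by have := leq_trans hr' (hL _ xL); rewrite leqNgt vtx_rank_lt.
  have F0 : paired set0 = set0 :> {set piece N M}.
    by apply/setP => x; rewrite in_paired !inE.
  by rewrite /cross_parity /paired_base F0; have -> : [set x in set0 | base x] = set0 :> {set piece N M};
    [apply/setP => x; rewrite !inE | apply: quad_form0].
have [/existsP[x /andP[xL /eqP xr]]|none] := boolP [exists x, (x \in L) && (vtx_rank x.1 == r)]; last first.
  apply: (IH r.+1) => // [|x xL]; first by lia.
  rewrite ltn_neqAle hL // andbT eq_sym.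
  by apply: contra none => h; apply/existsP; exists x; rewrite xL.
set v := x.1 in xr.
have pL y : y \in L -> mate y != y /\ mate y \in L by rewrite -{1}FL in_paired => /and3P[].
have bv y : y \in L -> y.1 = v -> base y.
  move=> yL yv; have [ym ymL] := pL _ yL; rewrite -vtx_rank_mate //.
  have := hL _ ymL; rewrite leq_eqVlt -xr -yv => /orP[/eqP /vtx_rank_inj /esym /eqP|//].
  by rewrite (negbTE (mate_vtx ym)).
have EN : ((v, dE) \in L) = ((v, dN) \in L).
  have := eL v.
  rewrite (_ : xsum L _ = xsum L (fun y => (y == (v, dE)) (+) (y == (v, dN)))).
    by rewrite xsumD !xsum_pred1; do 2!case: (_ \in L).
  apply: eq_xsum => -[w d] yL; rewrite !xpair_eqE /=; case: eqP => //= e.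
  by have := bv _ yL e; rewrite baseE /=; case: eqP => [->|_] //= ->.
have vE : (v, dE) \in L.
  have := bv _ xL erefl; rewrite baseE => /orP[] /eqP h.
    by rewrite -h /v -surjective_pairing.
  by rewrite EN -h /v -surjective_pairing.
have vN : (v, dN) \in L by rewrite -EN.
have [/mateE [/= n1 _] _] := pL _ vE; have [/mateE [/= n3 _] _] := pL _ vN.
have [u2 [n12 n32 /= [FL' eL' <-]]] := cross_parity_face FL eL n1 n3.
set u1 := (mate (v, dE)).1 in n1 n12 FL' eL' *.
set u3 := (mate (v, dN)).1 in n3 n32 FL' eL' *.
set L' := symdiff _ _ in FL' eL' *.
have lt u w k : base (u, k) -> nbr u k = Some w -> (vtx_rank u < vtx_rank w)%N.
  move=> b h; have m : mate (u, k) = (w, Defs.opp k) by rewrite /mate /= h.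
  have m1 : mate (u, k) != (u, k).
    by rewrite m xpair_eqE (negbTE (nbr_neq h)).
  by have := vtx_rank_mate m1; rewrite b m.
have l1 : (vtx_rank v < vtx_rank u1)%N by apply: lt n1.
have l3 : (vtx_rank v < vtx_rank u3)%N by apply: lt n3.
have l2 : (vtx_rank u1 < vtx_rank u2)%N by apply: lt n12.
apply: (IH r.+1) => // [|y yL']; first by lia.
have [yv|yv] := eqVneq y.1 v.
  move: yL'; rewrite !in_symdiff !in_set2; case: y yv => w d /= -> {w}.
  have V u : (vtx_rank v < vtx_rank u)%N -> (v == u) = false by case: eqP => // <-; rewrite ltnn.
  rewrite !xpair_eqE (V _ l1) (V _ l3) (V _ (ltn_trans l1 l2)) eqxx /= !orbF !addbF.
  have [->|dE'] := eqVneq d dE; first by rewrite vE.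
  have [->|dN'] := eqVneq d dN; first by rewrite vN.
  by rewrite !addbF => dL; have := bv _ dL erefl; rewrite baseE /= (negbTE dE') (negbTE dN').
suff : (r <= vtx_rank y.1)%N.
  by rewrite leq_eqVlt -xr => /orP[/eqP /vtx_rank_inj h|//]; rewrite h eqxx in yv.
move: yL'; rewrite !in_symdiff !in_set2.
case: (boolP (y \in L)) => [/hL //|_].
do 8![case: eqP => [->|_]; first by move=> _ /=; lia].
by [].
Qed.

End Planar.

(** * Decompositions of a configuration *)

Section Path.
Variables (N M : nat) (V : {set vtx N M}) (H : {set piece N M}).
Implicit Types (v w u : vtx N M) (k l : 'I_4) (p q x y e f : piece N M) (G L : {set piece N M}).

(* The crossing parity of the full edges together with the chord from [pa] to
   [zl]. *)
Definition phase_parity (pa zl : piece N M) G :=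
  cross_parity G (+) xsum G (fun x => prec zl x (+) prec x pa) (+) prec zl pa.

Hypothesis HV : forall p, p \in H -> p.1 \in V.

Lemma full_interior p : p \in H -> mate p \in H -> mate p != p -> interior_half V p.
Proof.
move=> pH mH /mateE [h _]; rewrite /interior_half HV //= h.
exact: HV mH.
Qed.

Lemma loneE p : p \in H -> lone V H p = (p \notin paired H).
Proof.
move=> pH; rewrite /lone in_paired pH /=; congr (~~ _).
apply/andP/andP => [[ip mH]|[mH mp]]; last by split=> //; apply: full_interior.
split=> //; move: ip; rewrite /interior_half HV //=.
by rewrite /mate; case e: nbr => [w|//] _; apply: contraNneq (nbr_neq e) => /(congr1 fst) /= ->.
Qed.

Lemma deg_le v : (deg H v <= 4)%N.
Proof.
rewrite /deg -[X in (_ <= X)%N](card_ord 4) -(card_in_imset (f := snd)); first exact: max_card.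
by move=> [w k] [w' k']; rewrite !inE /= => /andP[_ /eqP ->] /andP[_ /eqP ->] ->.
Qed.

Variable pr : piece N M -> piece N M.
Hypothesis prP : pairing H pr.

Lemma prH p : p \in H -> pr p \in H. Proof. by case/prP. Qed.
Lemma prK p : p \in H -> pr (pr p) = p. Proof. by case/prP. Qed.
Lemma pr_vtx p : p \in H -> (pr p).1 = p.1. Proof. by case/prP. Qed.
Lemma pr_dir p : p \in H -> (pr p).2 != p.2. Proof. by case/prP. Qed.
Lemma pr_neq p : p \in H -> pr p != p.
Proof. by move=> pH; apply: contraNneq (pr_dir pH) => {1}->. Qed.

Lemma deg4 x y : x \in H -> y \in H -> x.1 = y.1 -> x != y -> x != pr y -> deg H x.1 = 4%N.
Proof.
move=> xH yH xy n1 n2; apply/eqP; rewrite eqn_leq deg_le /=.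
pose s := [:: x; pr x; y; pr y].
have us : uniq s.
  rewrite /= !inE !negb_or n1 n2 (eq_sym x) pr_neq // (eq_sym y) pr_neq //= !andbT.
  apply/andP; split; first by apply: contraNneq n2 => <-; rewrite prK.
  by apply: contraNneq n1 => /(congr1 pr); rewrite !prK // => ->.
apply: (@leq_trans #|s|); first by rewrite (card_uniqP us).
apply: subset_leq_card; apply/subsetP => z.
by rewrite !inE => /or4P[] /eqP ->; rewrite ?prH ?pr_vtx ?xy ?eqxx //= ?xH ?yH.
Qed.

Lemma dir_noncross (a b c d : 'I_4) : uniq [:: a; b; c; d] -> b != Defs.opp a ->
  (b < c)%N (+) (b < d)%N = (a < c)%N (+) (a < d)%N.
Proof.
case: a => [[|[|[|[|]]]] la] //; case: b => [[|[|[|[|]]]] lb] //;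
case: c => [[|[|[|[|]]]] lc] //; by case: d => [[|[|[|[|]]]] ld].
Qed.

Lemma noncross G x : G \subset H -> {in G, forall y, pr y \in G} -> x \in H -> x \notin G ->
  xsum G (fun y => prec y x (+) prec y (pr x)) = false.
Proof.
move=> /subsetP sG cG xH xG.
apply: (@xsum_invol _ _ _ pr) => [y yG|y yG|y yG].
- by split; [apply: cG | apply: pr_neq; apply: sG].
- by rewrite prK // sG.
have yH := sG _ yG.
have [e|n] := eqVneq y.1 x.1; last first.
  by rewrite !prec_vtx ?pr_vtx.
have nyx : y != x by apply: contraNneq xG => <-.
have nyx' : y != pr x by apply: contraNneq xG => h; rewrite -(prK xH) -h cG.
rewrite !prec_dir ?pr_vtx //; apply: dir_noncross; last first.
  by case: (prP yH) => _ _ _ _; apply; apply: (@deg4 _ x).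
have U p q : p.1 = q.1 -> p != q -> p.2 != q.2.
  by case: p q => [w1 d1] [w2 d2] /= ->; rewrite xpair_eqE eqxx.
have n1 : y != pr y by rewrite eq_sym pr_neq.
have n2 : pr y != x by apply: contraNneq xG => <-; apply: cG.
have n3 : pr y != pr x by apply: contraNneq xG => h; rewrite -(prK xH) -h !cG.
have n4 : x != pr x by rewrite eq_sym pr_neq.
by rewrite /= !inE !negb_or !U ?pr_vtx.
Qed.

Lemma noncross_left G x : G \subset H -> {in G, forall y, pr y \in G} -> x \in H -> x \notin G ->
  xsum G (fun y => prec x y (+) prec (pr x) y) = false.
Proof.
move=> sG cG xH xG; rewrite -(noncross sG cG xH xG); apply: eq_xsum => y yG.
have nyx : y != x by apply: contraNneq xG => <-.
have nyx' : y != pr x by apply: contraNneq xG => h; rewrite -(prK xH) -h cG.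
by rewrite (precC nyx) (precC nyx'); do 2!case: (prec y _).
Qed.

Lemma closed_even G v : G \subset H -> {in G, forall y, pr y \in G} ->
  xsum G (fun y => y.1 == v) = false.
Proof.
move=> /subsetP sG cG.
apply: (@xsum_invol _ _ _ pr) => y yG.
- by split; [apply: cG | apply: pr_neq; apply: sG].
- by rewrite prK // sG.
by rewrite pr_vtx ?sG.
Qed.

Lemma closed_cross G L : [disjoint G & L] -> G \subset H -> L \subset H ->
  {in G, forall y, pr y \in G} -> {in L, forall y, pr y \in L} ->
  xsum L (fun x => xsum G (fun y => prec y x)) = false.
Proof.
move=> dGL sG sL cG cL; have sLs := subsetP sL.
apply: (@xsum_invol _ _ _ pr) => x xL.
- by split; [apply: cL | apply: pr_neq; apply: sLs].
- by rewrite prK // sLs.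
have xG : x \notin G by apply/negP => xG; move/pred0P: dGL => /(_ x) /=; rewrite xG xL.
have := noncross sG cG (sLs _ xL) xG; rewrite xsumD.
by case: (xsum _ _) => /=; case: (xsum _ _).
Qed.

End Path.

Section Path2.
Variables (N M : nat) (V : {set vtx N M}) (sig : piece N M -> bool) (H : {set piece N M}).
Implicit Types (v w u : vtx N M) (k l : 'I_4) (p q x y e f : piece N M) (G L : {set piece N M}).
Lemma xsum_paired G p q g : p \in G -> q \in G -> p != q ->
  p \notin paired G -> q \notin paired G ->
  (forall x, x \in G -> x != p -> x != q -> x \in paired G) ->
  xsum G g = g p (+) g q (+) xsum (paired G) g.
Proof.
move=> pG qG npq pF qF hF.
have -> : xsum G g = xsum (p |: (q |: paired G)) g.
  congr (xsum _ _); apply/setP => x; rewrite !in_setU1.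
  have [->//|np] := eqVneq x p; have [->//|nq] := eqVneq x q.
  by apply/idP/idP => [/hF -> //|]; rewrite in_paired => /and3P[].
by rewrite !xsumU1 ?in_setU1 ?negb_or ?npq // addbA.
Qed.

Variables (pa : piece N M) (pr : piece N M -> piece N M).
Hypothesis HV : forall p, p \in H -> p.1 \in V.
Hypothesis sigm : forall p, interior_half V p -> sig (mate p) = sig p.
Hypothesis prP : pairing H pr.
Hypothesis paH : pa \in H.
Hypothesis paL : pa \notin paired H.

Local Open Scope ring_scope.

(* [G] is the set of pieces covered by an initial part of the path, [q] its last
   piece; [wd] counts quarter turns and [b] is the voltage collected so far. *)
Record path_invariant G q (wd : int) (b : bool) : Prop := PathInvariant {
  pi_sub : G \subset H; pi_pa : pa \in G; pi_q : q \in G; pi_neq : q != pa;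
  pi_pr : {in G, forall x, pr x \in G};
  pi_mate : forall x, x \in G -> x != pa -> x != q ->
     [/\ mate x \in G, mate x != pa, mate x != q & mate x != x];
  pi_w : exists m : int, wd = q.2%:Z - pa.2%:Z - 2%:Z + 4 * (phase_parity pa q G)%:Z + 8 * m;
  pi_s : b = xsum (paired_base G) sig }.

Lemma turn_dir (a d : 'I_4) : d != a -> exists m : int,
  match ((d + 6 - a) %% 4)%N with 1%N => 1 | 3%N => -1 | _ => 0 end =
  d%:Z - a%:Z - 2%:Z + 4 * (d < a)%N%:Z + 8 * m.
Proof.
case: a => [[|[|[|[|a]]]] la] //; case: d => [[|[|[|[|d]]]] ld] // _;
first [by exists 0 | by exists 1 | by exists (-1)].
Qed.

Lemma path_invariant_base : path_invariant [set pa; pr pa] (pr pa) (turn pa (pr pa)) false.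
Proof.
have qH := prH prP paH; have nq := pr_neq prP paH; have qv := pr_vtx prP paH.
have mp : mate pa != pr pa.
  by apply: contraNneq paL => h; rewrite in_paired paH h qH nq.
have mq : mate (pr pa) != pa by rewrite mate_eq eq_sym.
have F0 : paired [set pa; pr pa] = set0.
  apply/setP => x; rewrite in_paired !inE; apply/negP => /and3P[/orP[] /eqP -> ];
    by rewrite ?(negbTE mp) ?(negbTE mq) /= ?orbF => h1 h2; rewrite h1 in h2.
split=> //; rewrite ?in_set2 ?eqxx ?orbT //.
- by apply/subsetP => x; rewrite in_set2 => /orP[] /eqP ->.
- by move=> x; rewrite !in_set2 => /orP[] /eqP ->; rewrite ?(prK prP) // ?eqxx ?orbT.
- by move=> x; rewrite in_set2 => /orP[] /eqP ->; rewrite eqxx.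
- have [m e] := turn_dir (pr_dir prP paH); exists m; rewrite [turn _ _]e /phase_parity /cross_parity /paired_base F0.
  have -> : [set x in set0 | base x] = set0 :> {set piece N M}.
    by apply/setP => x; rewrite !inE.
  rewrite quad_form0 xsumU1 ?xsum1 ?in_set1 1?eq_sym // !precxx (prec_dir qv).
  by do 2!case: (_ < _)%N.
by rewrite /paired_base F0 xsumE big1 // => x _; rewrite !inE.
Qed.

Lemma step_dir (a d' d e : 'I_4) (i : bool) : e = Defs.opp d -> d' != e -> exists m : int,
  match ((d' + 6 - e) %% 4)%N with 1%N => 1 | 3%N => -1 | _ => 0 end
    + (d%:Z - a%:Z - 2%:Z + 4 * i%:Z) =
  d'%:Z - a%:Z - 2%:Z + 4 * (~~ (i (+) ~~ (d < 2)%N (+) (d' < e)%N))%:Z + 8 * m.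
Proof.
move=> ->; case: d => [[|[|[|[|d]]]] ld] //; case: d' => [[|[|[|[|d']]]] ld'] //; case: i => // _ /=;
first [by exists 0; lia | by exists 1; lia | by exists (-1); lia].
Qed.

Lemma path_invariant_step G q wd b : path_invariant G q wd b -> ~~ lone V H q ->
  let p' := mate q in let q' := pr p' in
  path_invariant (q' |: (p' |: G)) q' (wd + turn p' q') (b (+) sig q).
Proof.
move=> I lq p' q'; have sG := subsetP (pi_sub I).
have [paG qG nq cG mG] : [/\ pa \in G, q \in G, q != pa, {in G, forall x, pr x \in G} &
   forall x, x \in G -> x != pa -> x != q ->
     [/\ mate x \in G, mate x != pa, mate x != q & mate x != x]] by case: I.
have qH := sG _ qG.
have : q \in paired H by rewrite -[_ \in _]negbK -(loneE HV).
rewrite in_paired => /and3P[_ p'H mqq]; rewrite -/p' in p'H mqq.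
have q'H : q' \in H by apply: (prH prP).
have p'pa : p' != pa.
  by apply: contraNneq paL => h; rewrite in_paired paH -h /p' mateK qH eq_sym.
have p'G : p' \notin G.
  apply/negP => h; have [_ _] := mG _ h p'pa mqq.
  by rewrite /p' mateK eqxx.
have q'p' : q' != p' by apply: (pr_neq prP).
have q'G : q' \notin G by apply: contra p'G => /cG; rewrite /q' (prK prP).
have q'pa : q' != pa by apply: contraNneq q'G => ->.
have q'q : q' != q by apply: contraNneq q'G => ->.
have q'v : q'.1 = p'.1 by apply: (pr_vtx prP).
have mq' : mate q' \notin p' |: G.
  rewrite in_setU1 negb_or; apply/andP; split.
    by rewrite mate_eq /p' mateK.
  apply/negP => h; have [e|npa] := eqVneq (mate q') pa.
    have mpa : mate pa = q' by rewrite -e mateK.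
    by move/negP: paL; apply; rewrite in_paired paH mpa q'H q'pa.
  have [e|nq'] := eqVneq (mate q') q; first by move: q'p'; rewrite /p' -e mateK eqxx.
  by have [] := mG _ h npa nq'; rewrite mateK (negbTE q'G).
have q'U : q' \notin p' |: G by rewrite in_setU1 negb_or q'p'.
have qF : q \notin paired G by rewrite in_paired (negbTE p'G) andbF.
have paF : pa \notin paired G.
  by apply: contra paL; rewrite !in_paired => /and3P[_ /sG -> ->]; rewrite paH.
have hF x : x \in G -> x != pa -> x != q -> x \in paired G.
  by move=> xG h1 h2; have [m1 _ _ m2] := mG _ xG h1 h2; rewrite in_paired xG m1.
have nq2 : pa != q by rewrite eq_sym.
have xF g := xsum_paired g paG qG nq2 paF qF hF.
have mp'G : mate p' \in G by rewrite mateK.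
have Qeq : cross_parity (q' |: (p' |: G)) = cross_parity G (+) ~~ xsum (paired G) (fun x => prec p' x (+) prec q x).
  by rewrite cross_parity_lone // cross_parity_add // /p' mateK.
have Ieq : phase_parity pa q' (q' |: (p' |: G)) = ~~ (phase_parity pa q G (+) prec p' q (+) prec q' p').
  rewrite /phase_parity Qeq !xsumU1 // !precxx /=.
  have := noncross_left prP (pi_sub I) cG p'H p'G.
  have := xF (fun x => prec p' x (+) prec q x).
  rewrite -/q' !xsumD precxx /=.
  set z1 := xsum (paired G) _; set z2 := xsum (paired G) _.
  set z3 := xsum G (prec p'); set z4 := xsum G (prec q); set z5 := xsum G (prec q').
  move=> e1 e2; have -> : z5 = z3 by move: e2; case: (z3) (z5) => [] [].
  have -> : z1 (+) z2 = z3 (+) z4 (+) (prec p' pa (+) prec q pa) (+) prec p' q.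
    by rewrite e1 addbF; move: (prec p' pa) (prec q pa) (prec p' q) (z1 (+) z2); do 4!case.
  move: (cross_parity G) (prec p' pa) (prec q pa) (prec p' q) (prec q' p') (xsum G _) (prec q' pa) (z3) (z4).
  by do 9!case.
split.
- apply/subsetP => x; rewrite !in_setU1 => /or3P[/eqP ->|/eqP ->|/sG] //.
- by rewrite !in_setU1 paG !orbT.
- by rewrite in_setU1 eqxx.
- by [].
- move=> x; rewrite !in_setU1 => /or3P[/eqP ->|/eqP ->|/cG ->].
  + by rewrite /q' (prK prP) // eqxx orbT.
  + by rewrite eqxx.
  + by rewrite !orbT.
- move=> x; rewrite !in_setU1 => /or3P[/eqP ->|/eqP ->|xG] npa nq'.
  + by rewrite eqxx in nq'.
  + by rewrite /p' mateK qG !orbT nq eq_sym q'q eq_sym.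
  + have [->|nxq] := eqVneq x q.
      by rewrite -/p' eqxx orbT p'pa eq_sym q'p' mqq.
    have [mG1 mG2 mG3 mG4] := mG _ xG npa nxq.
    by rewrite mG1 !orbT; split=> //; apply: contraNneq q'G => <-.
- have [m em] := pi_w I.
  have ed : p'.2 = Defs.opp q.2 := (mateE mqq).2.
  have [m' em'] := step_dir pa.2 (phase_parity pa q G) ed (pr_dir prP p'H).
  exists (m + m'); rewrite Ieq (@precC _ _ q p') 1?eq_sym // prec_mate // (prec_dir q'v).
  have {}em' : turn p' q' + (q.2%:Z - pa.2%:Z - 2%:Z + 4 * (phase_parity pa q G)%:Z) = _ := em'.
  move: em'; rewrite em /base -/q'.
  move: (turn p' q') (phase_parity _ _ _) => t i; move: (~~ _) => j.
  by clear; lia.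
have [rF eF] := paired_base_add p'G mp'G.
have -> : paired_base (q' |: (p' |: G)) = paired_base (p' |: G) by rewrite /paired_base paired_lone.
rewrite eF xsumU1 // -(pi_s I) addbC; congr (_ (+) _); rewrite /base_half; case: ifP => _.
  by rewrite /p' sigm // (full_interior HV).
by rewrite /p' mateK.
Qed.

End Path2.

Section Rest.
Variables (N M : nat) (V : {set vtx N M}) (sig : piece N M -> bool) (H : {set piece N M}).
Implicit Types (v w u : vtx N M) (k l : 'I_4) (p q x y e f : piece N M) (G L : {set piece N M}).
Variables (pa : piece N M) (pr : piece N M -> piece N M).
Hypothesis prP : pairing H pr.

Lemma xsum_exchange (T : finType) (A B : {set T}) (f : T -> T -> bool) :
  xsum A (fun a => xsum B (f a)) = xsum B (fun b => xsum A (f^~ b)).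
Proof. by rewrite /xsum exchange_big. Qed.

Lemma pr_compl G : G \subset H -> {in G, forall x, pr x \in G} ->
  {in H :\: G, forall x, pr x \in H :\: G}.
Proof.
move=> /subsetP sG cG x; rewrite !inE => /andP[xG xH]; rewrite (prH prP) // andbT.
by apply: contra xG => /cG; rewrite (prK prP).
Qed.

Lemma cross_parity_closed L : L \subset H -> {in L, forall x, pr x \in L} -> paired L = L ->
    cross_parity L = false.
Proof. by move=> sL cL FL; apply: cross_parity_even => // v; apply: (closed_even prP). Qed.

Lemma odd_closed L : L \subset H -> {in L, forall x, pr x \in L} -> xsum L (fun=> true) = false.
Proof.
move=> /subsetP sL cL; apply: (@xsum_invol _ _ _ pr) => x xL //.
  by split; [apply: cL | apply: (pr_neq prP); apply: sL].
by rewrite (prK prP) // sL.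
Qed.

Variable (q : piece N M) (wd : int) (b : bool) (G : {set piece N M}).
Hypothesis I : path_invariant sig H pa pr G q wd b.
Hypothesis paL : pa \notin paired H.
Hypothesis qL : q \notin paired H.
Hypothesis loneH : forall x, x \in H -> x \notin paired H -> x = pa \/ x = q.

Lemma paired_rest : paired (H :\: G) = H :\: G.
Proof.
apply/setP => x; rewrite in_paired; case: (boolP (x \in H :\: G)) => //=.
rewrite !inE => /andP[xG xH].
have : x \in paired H.
  by apply/negPn/negP => /(loneH xH) [] e; move: xG; rewrite e ?(pi_pa I) ?(pi_q I).
rewrite in_paired => /and3P[_ mH ->]; rewrite mH !andbT.
apply/negP => mG; have mH' := subsetP (pi_sub I) _ mG.
have mF : mate x \in paired H.
  rewrite in_paired mH' mateK xH eq_sym; apply: contraNneq xG => e.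
  by rewrite -e.
have npa : mate x != pa by apply: contraNneq paL => <-.
have nq : mate x != q by apply: contraNneq qL => <-.
by have [] := pi_mate I mG npa nq; rewrite mateK (negbTE xG).
Qed.

Lemma paired_base_split : paired_base H = paired_base G :|: paired_base (H :\: G).
Proof.
apply/setP => x; rewrite in_setU !(in_set (fun x => _ && base x)) -andb_orl; congr (_ && _).
rewrite paired_rest !in_paired inE.
case: (boolP (x \in G)) => xG /=; last first.
  have [xH|//] := boolP (x \in H) => /=.
  have : x \in paired (H :\: G) by rewrite paired_rest inE xG.
  by rewrite in_paired inE => /and3P[_ + ->]; rewrite inE => /andP[_ ->].
rewrite orbF (subsetP (pi_sub I) _ xG) /=.
have [->|npa] := eqVneq x pa.
  have := paL; rewrite in_paired (subsetP (pi_sub I) _ (pi_pa I)) /= => /negbTE ->.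
  apply/esym/negbTE; apply: contra paL => /andP[h1 h2].
  by rewrite in_paired (subsetP (pi_sub I) _ (pi_pa I)) (subsetP (pi_sub I) _ h1).
have [->|nq] := eqVneq x q.
  have := qL; rewrite in_paired (subsetP (pi_sub I) _ (pi_q I)) /= => /negbTE ->.
  apply/esym/negbTE; apply: contra qL => /andP[h1 h2].
  by rewrite in_paired (subsetP (pi_sub I) _ (pi_q I)) (subsetP (pi_sub I) _ h1).
have [h1 _ _ h2] := pi_mate I xG npa nq.
by rewrite h1 h2 (subsetP (pi_sub I) _ h1).
Qed.

Lemma paired_base_disj : [disjoint paired_base G & paired_base (H :\: G)].
Proof.
by apply/pred0P => x /=; rewrite !in_paired_base !inE; case: (x \in G); rewrite ?andbF.
Qed.

Lemma phase_parity_rest : phase_parity pa q H = phase_parity pa q G.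
Proof.
have sG := pi_sub I; have cG := pi_pr I.
have sL : H :\: G \subset H by apply: subsetDl.
have cL := pr_compl sG cG.
have dGL : [disjoint G & H :\: G].
  by apply/pred0P => x /=; rewrite !inE; case: (x \in G).
have defH : H = G :|: (H :\: G).
  by apply/setP => x; rewrite !inE; case: (boolP (x \in G)) => // /(subsetP sG).
pose g y := xsum (H :\: G) (prec y).
have gF : g pa (+) g q (+) xsum (paired G) g = false.
  rewrite -(@xsum_paired _ _ G pa q); first last.
  - by move=> x xG h1 h2; have [h3 _ _ h4] := pi_mate I xG h1 h2; rewrite in_paired xG h3 h4.
  - apply: contra qL; rewrite !in_paired => /and3P[h1 h2 ->].
    by rewrite !(subsetP sG).
  - apply: contra paL; rewrite !in_paired => /and3P[h1 h2 ->].
    by rewrite !(subsetP sG).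
  - by rewrite eq_sym (pi_neq I).
  - exact: pi_q I.
  - exact: pi_pa I.
  by rewrite xsum_exchange; apply: closed_cross dGL sG sL cG cL.
have Qe : cross_parity H = cross_parity G (+) xsum (paired G) g.
  rewrite [in LHS]/cross_parity paired_base_split quad_formU; last 2 first.
  - exact: paired_base_disj.
  - move=> x y; rewrite -paired_base_split !in_paired_base => /and4P[_ _ h1 h2] /and4P[_ _ h3 h4].
    by rewrite crossing_sym.
  rewrite -/(cross_parity G) -/(cross_parity (H :\: G)) (cross_parity_closed sL cL paired_rest) addbF; congr (_ (+) _).
  rewrite -xsum_base; apply: eq_xsum => e _; rewrite xsum_crossing paired_rest xsumD //.
rewrite /phase_parity Qe {1}defH xsumU // !xsumD.
have -> : xsum (H :\: G) (fun x => prec x pa) = g pa.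
  transitivity (xsum (H :\: G) (fun x => prec pa x (+) true)).
    apply: eq_xsum => x; rewrite !inE => /andP[xG _]; rewrite addbT; apply: precC.
    by apply: contraNneq xG => <-; apply: pi_pa I.
  by rewrite xsumD (odd_closed sL cL) addbF.
rewrite -/(g q); move: gF.
move: (cross_parity G) (xsum (paired G) g) (g pa) (g q) (xsum G (prec q)) (xsum G (fun x => prec x pa)) (prec q pa).
by do 7!case.
Qed.

Lemma xsum_base_rest h :
  xsum (paired_base H) h = xsum (paired_base G) h (+) xsum (paired_base (H :\: G)) h.
Proof. by rewrite paired_base_split xsumU // paired_base_disj. Qed.

End Rest.

Section Loops.
Variables (N M : nat) (V : {set vtx N M}) (sig : piece N M -> bool) (H : {set piece N M}).
Variables (pr : piece N M -> piece N M) (es : seq (piece N M)).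
Hypothesis HV : forall p, p \in H -> p.1 \in V.
Hypothesis prP : pairing H pr.
Let L := H :\: pathset pr es.
Hypothesis cL : {in L, forall x, pr x \in L}.
Hypothesis FL : paired L = L.

Lemma nodd_parity : odd (nodd V sig H pr es) = xsum (paired_base L) sig.
Proof.
pose R := lk V H pr.
have sLH : {subset L <= H} by move=> x; rewrite inE => /andP[].
have mL x : x \in L -> mate x \in L by rewrite -{1}FL in_paired => /and3P[].
have pL x : x \in L -> mate x != x by rewrite -{1}FL in_paired => /and3P[].
have iL x : x \in L -> interior_half V x.
  by move=> xL; apply: (full_interior HV); rewrite ?sLH ?mL ?pL.
have Rs x y : R x y -> R y x.
  case/and3P=> xH yH /orP[/eqP e|/andP[ix /eqP e]].
    by rewrite /R /lk xH yH e (prK prP) // eqxx.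
  have mx : mate x != x.
    by move: ix; rewrite /interior_half /mate; case h: nbr => [w|]; rewrite ?andbF // => _;
       apply: contraNneq (nbr_neq h) => /(congr1 fst) /= ->.
  rewrite /R /lk xH yH e mateK eqxx andbT; apply/orP; right.
  by apply: (full_interior HV); rewrite ?mateK -?e // e eq_sym.
have RL x y : x \in L -> R x y -> y \in L.
  move=> xL /and3P[xH yH /orP[/eqP ->|/andP[_ /eqP ->]]]; [exact: cL | exact: mL].
have cRL x y : x \in L -> connect R x y -> y \in L.
  move=> xL /connectP[s ps ->]; elim: s x xL ps => //= z s IH x xL /andP[h ps].
  by apply: IH ps; apply: RL xL h.
have csym : connect_sym R by apply: sym_connect_sym => x y; apply/idP/idP; apply: Rs.
have eqv : {in L & &, equivalence_rel (connect R)}.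
  by move=> x y z _ _ _; split; [apply: connect0 | move=> h; apply: same_connect].
pose P := equivalence_partition (connect R) L.
have partP : partition P L by apply: equivalence_partitionP.
have PE : [set [set q | connect R p q] | p in L] = P.
  apply: eq_in_imset => p pLL /=; apply/setP => z; rewrite [LHS]in_set [RHS]in_set.
  by case: (boolP (connect R p z)) => h; rewrite ?andbF // (cRL p).
rewrite /nodd -/L -/R PE.
pose c (C : {set piece N M}) := odd #|[set q in C | [&& base q, interior_half V q & sig q]]|.
rewrite odd_card.
have -> : xsum (paired_base L) sig = \big[addb/false]_(x in L) (base x && sig x).
  rewrite xsumE big_mkcond [RHS]big_mkcond; apply: eq_bigr => x _ /=.
  rewrite /paired_base FL inE; by case: (x \in L).
have [/eqP <- tI _] := and3P partP.
rewrite big_trivIset //=; apply: eq_bigr => C CP.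
rewrite odd_card; apply: eq_bigr => x xC.
have xL : x \in L.
  by have [/eqP <- _ _] := and3P partP; apply/bigcupP; exists C.
by rewrite iL.
Qed.

End Loops.

Section Exists.
Variables (N M : nat) (V : {set vtx N M}) (H : {set piece N M}).
Implicit Types (v w u : vtx N M) (k l : 'I_4) (p q x y e f : piece N M).
Hypothesis HV : forall p, p \in H -> p.1 \in V.
Hypothesis degH : forall v, deg H v \in [:: 0; 2; 4]%N.

Definition swap_dir (k : 'I_4) : 'I_4 := nth dE [:: dN; dE; dS; dW] k.

Definition greedy_pairing p : piece N M :=
  if deg H p.1 == 4%N then (p.1, swap_dir p.2)
  else odflt p [pick q in H | (q.1 == p.1) && (q != p)].

Lemma deg4_mem v k : deg H v = 4%N -> (v, k) \in H.
Proof.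
move=> d4; have : [set l | (v, l) \in H] = setT.
  apply/eqP; rewrite eqEcard subsetT cardsT card_ord -[X in (X <= _)%N]d4 /deg.
  have -> : [set p in H | p.1 == v] = [set (v, l) | l in [set l | (v, l) \in H]].
    apply/setP => -[w l]; rewrite !inE /=; apply/andP/imsetP => [[h /eqP e]|[l' ]].
      by exists l; rewrite ?inE -e.
    by rewrite inE => h [-> ->].
  exact: leq_imset_card.
by move/setP/(_ k); rewrite !inE.
Qed.

Lemma greedy_pairingP : pairing H greedy_pairing.
Proof.
move=> [v k] pH; rewrite /greedy_pairing /=.
case: ifP => [/eqP d4|/eqP d4].
  rewrite /= d4 eqxx; split=> //.
  - exact: deg4_mem.
  - by congr (_, _); apply: val_inj; case: k {pH} => [[|[|[|[|k]]]] lk].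
  - by case: k {pH} => [[|[|[|[|k]]]] lk].
  - by case: k {pH} => [[|[|[|[|k]]]] lk].
have d2 : deg H v = 2%N.
  have := degH v; rewrite !inE => /or3P[/eqP d0|/eqP//|/eqP//].
  move: d0; rewrite /deg => /eqP; rewrite cards_eq0 => /eqP/setP/(_ (v, k)).
  by rewrite !inE pH eqxx.
have : #|[set p in H | p.1 == v] :\ (v, k)| == 1%N.
  by have := cardsD1 (v, k) [set p in H | p.1 == v]; rewrite -/(deg H v) d2 inE pH eqxx /= add1n => -[<-].
case/cards1P => -[w l] /setP hq.
have hq' (x : piece N M) : (x \in H) && ((x.1 == v) && (x != (v, k))) = (x == (w, l)).
  by have := hq x; rewrite !inE => <-; rewrite andbC -andbA andbC -andbA.
have := hq' (w, l); rewrite eqxx /= => /and3P[qH /eqP qv qn]; subst w.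
case: pickP => [x|/(_ (v, l))]; rewrite hq' ?eqxx // => /eqP -> /=.
rewrite d2 /=; split=> //.
- case: pickP => [y /and3P[yH yv yq]|/(_ (v, k))] /=; last first.
    by rewrite pH eqxx eq_sym qn.
  by apply/eqP; apply: contraT => yn; have := hq' y; rewrite yH yv yn (negbTE yq).
by move: qn; rewrite xpair_eqE eqxx.
Qed.

Variables (pr : piece N M -> piece N M) (pa : piece N M).
Hypothesis prP : pairing H pr.
Hypothesis paH : pa \in H.
Hypothesis paL : pa \notin paired H.

(* Otherwise the orbit of [pa] under [mate \o pr] would be periodic, making [pa]
   the mate of a piece of [H]. *)
Lemma path_exists : exists es, path_ok V H pr pa es.
Proof.
pose f p := mate (pr p).
have fH p : p \in H -> pr p \in paired H -> f p \in H.
  by move=> _; rewrite in_paired => /and3P[].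
have finj : {in H &, injective f}.
  by move=> x y xH yH /(@mate_inj N M) /(congr1 pr); rewrite !(prK prP).
have Hi i : (forall j, (j < i)%N -> pr (iter j f pa) \in paired H) -> iter i f pa \in H.
  elim: i => //= i IH h; apply: fH; last by apply: h.
  by apply: IH => j ji; apply: h; rewrite ltnW.
have [i0 hi0] : exists i, pr (iter i f pa) \notin paired H.
  case: (boolP [exists i : 'I_#|{: piece N M}|.+1, pr (iter i f pa) \notin paired H]).
    by case/existsP => i h; exists i.
  rewrite negb_exists => /forallP h; exfalso.
  have hF j : (j <= #|{: piece N M}|)%N -> pr (iter j f pa) \in paired H.
    by move=> lj; have := h (inord j); rewrite inordK // negbK.
  have hH j : (j <= #|{: piece N M}|)%N -> iter j f pa \in H.
    by move=> lj; apply: Hi => l lt; apply: hF; apply: leq_trans (ltnW lt) lj.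
  have [/injectiveP inj|] := boolP (injectiveb (fun i : 'I_#|{: piece N M}|.+1 => iter i f pa)).
    by have := leq_card _ inj; rewrite card_ord ltnn.
  case/injectivePn => i [j nij eij].
  wlog lij : i j nij eij / (i < j)%N.
    move=> W; case: (ltngtP i j) => [lt|gt|e]; first exact: (W i j).
      by apply: (W j i); rewrite // eq_sym.
    by move/eqP: nij; apply; apply: val_inj.
  have lj : (j <= #|{: piece N M}|)%N by rewrite -ltnS.
  have back m d : (m + d <= #|{: piece N M}|)%N ->
      iter m f pa = iter (m + d) f pa -> pa = iter d f pa.
    elim: m => //= m IH lmd /finj eq; apply: IH; first exact: ltnW.
    by apply: eq; apply: hH; [apply: leq_trans (leq_addr d m) _|]; apply: ltnW.
  have := back i (j - i)%N; rewrite subnKC; last exact: ltnW.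
  move=> /(_ lj eij).
  case e : (j - i)%N => [|n]; first by move: lij; rewrite -subn_gt0 e.
  rewrite iterS => paE.
  have : pr (iter n f pa) \in paired H.
    by apply: hF; apply: leq_trans lj; apply: leq_trans (leq_subr i j); rewrite e.
  rewrite in_paired => /and3P[h1 h2 h3].
  by move/negP: paL; apply; rewrite in_paired paE /f mateK h2 h1 eq_sym.
have [i hi imin] : exists2 i, pr (iter i f pa) \notin paired H &
    forall j, (j < i)%N -> pr (iter j f pa) \in paired H.
  have ex : exists i, pr (iter i f pa) \notin paired H by exists i0.
  case: (ex_minnP ex) => m h1 h2; exists m => // j lj.
  by apply: contraTT lj => h; rewrite -leqNgt; apply: h2.
have iH j : (j <= i)%N -> iter j f pa \in H.
  by move=> lj; apply: Hi => l lt; apply: imin; apply: leq_trans lt lj.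
exists (traject f pa i.+1); split=> //; last first.
  by rewrite /= last_traject (loneE HV) // (prH prP) // iH.
move=> j; rewrite size_traject => lj.
have e n : (n <= i)%N -> nth pa (traject f pa i.+1) n = iter n f pa.
  by move=> ln; rewrite nth_traject.
rewrite !e //; last exact: ltnW.
split=> //; rewrite (loneE HV); first by rewrite negbK imin.
by apply: (prH prP); apply: iH; apply: ltnW.
Qed.

End Exists.

Lemma addb_xorb a b : a (+) b = xorb a b. Proof. by case: a b => [] []. Qed.

Ltac xor_tauto :=
  rewrite ?addb_xorb; btauto.

(** * Toggling the pieces of a corner *)

Section Corner.
Variables (N M : nat).
Implicit Types (v w u : vtx N M) (k l : 'I_4) (p q x y e f : piece N M) (H R S T : {set piece N M}).

Lemma phase_parity_lone pa z R : z \notin R -> mate z \notin R ->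
  phase_parity pa z (z |: R) = cross_parity R (+) xsum R (prec z) (+) xsum R (fun x => prec x pa).
Proof.
move=> h1 h2; rewrite /phase_parity cross_parity_lone // xsumU1 // precxx xsumD /=.
by case: (prec z pa) (cross_parity R) (xsum R _) (xsum R _) => [] [] [] [].
Qed.

Variables (v : vtx N M) (p q c : piece N M) (k3 : bool).
(* The corner pieces [p] and [q] are consecutive in the order, unless they are
   the last and the first piece of the vertex, which is recorded by [k3]. *)
Hypothesis adj : forall x, prec p x (+) prec q x = (x == c) (+) (k3 && (x.1 == v)).
Hypothesis cpq : c = p \/ c = q.
Variable pa : piece N M.

Lemma xsum_adj R : p \notin R -> q \notin R ->
  xsum R (prec p) (+) xsum R (prec q) = k3 && xsum R (fun x => x.1 == v).
Proof.
move=> pR qR; rewrite -xsumD -xsumM -[RHS]addFb.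
have <- : (c \in R) = false by case: cpq => ->; apply: negbTE.
by rewrite -(xsum_pred1 R c) -xsumD; apply: eq_xsum => x _; rewrite adj.
Qed.

Lemma phase_parity_near_near R : p \notin R -> q \notin R -> mate p \notin R -> mate q \notin R ->
  phase_parity pa p (p |: R) (+) phase_parity pa q (q |: R) = k3 && xsum R (fun x => x.1 == v).
Proof.
move=> pR qR mpR mqR; rewrite -xsum_adj // !phase_parity_lone //.
by case: (cross_parity R) (xsum R _) (xsum R _) (xsum R _) => [] [] [] [].
Qed.

Lemma phase_parity_near_far R S : R = mate q |: S ->
  p != q -> mate q != q -> mate p != q -> p \notin R -> q \notin R -> mate p \notin R ->
    mate q \notin S ->
  pa \in S -> (forall x, x \in R -> (x \in paired R) = (x != pa) && (x != mate q)) ->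
  prec p (mate q) = base q ->
  phase_parity pa p (p |: (q |: R)) (+) phase_parity pa (mate q) R =
  ~~ (k3 && xsum R (fun x => x.1 == v)) (+) base q (+) prec p q.
Proof.
move=> eR npq mqq mpq pR qR mpR mqS paS FR spq.
have qS : q \notin S by apply: contra qR => h; rewrite eR in_setU1 h orbT.
have mqR : mate q \in R by rewrite eR in_setU1 eqxx.
have paR : pa \in R by rewrite eR in_setU1 paS orbT.
have npa : pa != mate q by apply: contraNneq mqS => <-.
have F g : xsum R g = g pa (+) g (mate q) (+) xsum (paired R) g.
  apply: xsum_paired => // [||x xR h1 h2]; rewrite FR ?eqxx ?andbF ?h1 ?h2 //.
have pU : p \notin q |: R by rewrite in_setU1 negb_or npq.
have mpU : mate p \notin q |: R by rewrite in_setU1 negb_or mpq.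
have IR : phase_parity pa (mate q) R = cross_parity R (+) xsum R (prec (mate q)) (+) xsum S (fun x => prec x pa).
  by rewrite eR phase_parity_lone ?mateK // cross_parity_lone ?mateK // xsumU1 // precxx.
rewrite phase_parity_lone // IR cross_parity_add // -(xsum_adj pR qR) !(xsumU1 _ qR).
have -> : xsum R (fun x => prec x pa) = prec (mate q) pa (+) xsum S (fun x => prec x pa).
  by rewrite eR xsumU1.
have := F (fun x => prec q x (+) prec (mate q) x).
rewrite xsumD precxx prec_mate //.
move: (xsum (paired R) _) (cross_parity R) (xsum R (prec p)) (xsum R (prec q)) (xsum R (prec (mate q))) (xsum S (fun x => prec x pa)).
move: (prec p q) (prec q pa) (prec (mate q) pa) (base q).
by do 10!case.
Qed.

Lemma phase_parity_far_far T :
  p != q -> mate p != p -> mate q != q -> mate p != mate q -> mate p != q ->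
  p \notin T -> q \notin T -> mate p \notin T -> mate q \notin T -> pa \in T ->
  (forall x, x \in T -> (x \in paired T) = (x != pa)) ->
  prec (mate p) q = ~~ base p -> prec (mate q) p = ~~ base q ->
  phase_parity pa (mate p) (mate p |: (q |: (mate q |: T))) (+)
  phase_parity pa (mate q) (mate q |: (p |: (mate p |: T))) =
  ~~ (k3 && xsum T (fun x => x.1 == v)) (+) base p (+) base q.
Proof.
move=> npq mpp mqq nmm mpq pT qT mpT mqT paT FT s1 s2.
have F g : xsum T g = g pa (+) xsum (paired T) g.
  have -> : T = pa |: paired T.
    apply/setP => x; rewrite in_setU1; have [->//|nx] := eqVneq x pa.
    case: (boolP (x \in T)) => xT; first by rewrite FT // nx.
    by rewrite in_paired (negbTE xT).
  have FF : paired (pa |: paired T) = paired T.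
    congr paired; apply/setP => x; rewrite in_setU1; have [->//|nx] := eqVneq x pa.
    case: (boolP (x \in T)) => xT; first by rewrite FT // nx.
    by rewrite in_paired (negbTE xT).
  by rewrite FF xsumU1 // FT // eqxx.
have mqp : mate q != p by rewrite mate_eq eq_sym.
have E := (negbTE npq, negbTE mpp, negbTE mqq, negbTE nmm, negbTE mpq, negbTE mqp).
have E' : ((q == p) = false) * ((p == mate p) = false) * ((q == mate q) = false) *
    ((mate q == mate p) = false) * ((q == mate p) = false) * ((p == mate q) = false).
  by do !split; rewrite eq_sym E.
have D := (negbTE pT, negbTE qT, negbTE mpT, negbTE mqT).
have W := (in_setU1, E, E', D).
have -> : phase_parity pa (mate p) (mate p |: (q |: (mate q |: T))) =
    cross_parity T (+) ~~ xsum (paired T) (fun x => prec q x (+) prec (mate q) x) (+)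
    xsum (q |: (mate q |: T)) (prec (mate p)) (+) xsum (q |: (mate q |: T)) (fun x => prec x pa).
  rewrite phase_parity_lone ?mateK ?W // cross_parity_add ?W ?eqxx //.
  by rewrite cross_parity_lone ?paired_lone ?mateK ?W.
have -> : phase_parity pa (mate q) (mate q |: (p |: (mate p |: T))) =
    cross_parity T (+) ~~ xsum (paired T) (fun x => prec p x (+) prec (mate p) x) (+)
    xsum (p |: (mate p |: T)) (prec (mate q)) (+) xsum (p |: (mate p |: T)) (fun x => prec x pa).
  rewrite phase_parity_lone ?mateK ?W // cross_parity_add ?W ?eqxx //.
  by rewrite cross_parity_lone ?paired_lone ?mateK ?W.
rewrite -(xsum_adj pT qT) !xsumU1 ?W // !F !xsumD s1 s2 (@precC _ _ (mate p) (mate q)) //.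
by xor_tauto.
Qed.

Lemma phase_parity_near_start R : p \notin R -> q \notin R -> mate q \notin p |: R ->
    mate p \notin R ->
  q != p -> even_deg R -> xsum R (fun=> true) = false -> cross_parity R = false ->
  phase_parity p q (q |: (p |: R)) = prec q p.
Proof.
move=> pR qR mqU mpR nqp eR oR QR.
have qU : q \notin p |: R by rewrite in_setU1 negb_or nqp.
rewrite phase_parity_lone // cross_parity_lone // QR !xsumU1 // precxx.
have h := xsum_adj pR qR; rewrite eR andbF in h.
have -> : xsum R (fun x => prec x p) = xsum R (prec p).
  rewrite -[RHS]addFb -oR -xsumD; apply: eq_xsum => x xR.
  by apply: precC; apply: contraNneq pR => ->.
have -> : xsum R (prec q) = xsum R (prec p) by move: h; case: (xsum _ _) => /=; case: (xsum _ _).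
by case: (xsum _ _); case: (prec q p).
Qed.

Lemma phase_parity_far_start T : p != q -> mate q != q -> mate q != p ->
  p \notin T -> q \notin T -> mate q \notin T -> mate p \notin mate q |: T ->
  paired T = T -> xsum T (fun=> true) = false -> cross_parity (q |: (mate q |: T)) = false ->
  prec (mate q) p = ~~ base q ->
  phase_parity p (mate q) (mate q |: (p |: T)) = (k3 && xsum T (fun x => x.1 == v)) (+) base q.
Proof.
move=> npq mqq mqp pT qT mqT mpU FT oT Q0 s2.
have [mpT nmm] : mate p \notin T /\ mate q != mate p.
  by move: mpU; rewrite in_setU1 negb_or eq_sym => /andP[].
have mU : mate q \notin p |: T by rewrite in_setU1 negb_or mqp.
have qU : q \notin p |: T by rewrite in_setU1 negb_or eq_sym npq.
have qU' : q \notin mate q |: T by rewrite in_setU1 negb_or eq_sym mqq.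
rewrite phase_parity_lone ?mateK // cross_parity_lone // !xsumU1 // s2 precxx -(xsum_adj pT qT).
move: Q0; rewrite cross_parity_add ?in_setU1 ?eqxx //; last by rewrite -in_setU1.
rewrite cross_parity_lone ?paired_lone ?mateK // FT xsumD.
have -> : xsum T (fun x => prec x p) = xsum T (prec p).
  rewrite -[RHS]addFb -oT -xsumD; apply: eq_xsum => x xT.
  by apply: precC; apply: contraNneq pT => ->.
move: (xsum T (prec q)) (xsum T (prec p)) (xsum T (prec (mate q))) (cross_parity T) (base q) => [] [] [] [] [] //=.
Qed.

End Corner.

Local Open Scope ring_scope.

(** * Sixteenth roots of unity and the intrinsic form of the weight *)

Section Omega.
Let s2 : algC := sqrtC 2.
Let c : algC := sqrtC (2 + s2).
Let d : algC := sqrtC (2 - s2).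

Lemma s2E : s2 ^+ 2 = 2. Proof. exact: sqrtCK. Qed.
Lemma s2_gt0 : 0 < s2. Proof. by rewrite sqrtC_gt0 ltr0n. Qed.
Lemma s2_lt2 : s2 < 2.
Proof.
rewrite -(ltr_pXn2r (n := 2)) ?nnegrE ?ltW ?s2_gt0 ?ltr0n // s2E.
by rewrite -natrX ltr_nat.
Qed.
Lemma d_ge0 : 0 <= d. Proof. by rewrite sqrtC_ge0 subr_ge0 ltW ?s2_lt2. Qed.
Lemma c_ge0 : 0 <= c. Proof. by rewrite sqrtC_ge0 addr_ge0 ?ltW ?s2_gt0 ?ltr0n. Qed.
Lemma cdE : c * d = s2.
Proof.
rewrite -sqrtCM ?nnegrE ?subr_ge0 ?(ltW s2_lt2) //; last first.
  by rewrite addr_ge0 ?ltW ?s2_gt0 ?ltr0n.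
congr sqrtC; have := s2E; rewrite expr2 => h.
have -> : (2 + s2) * (2 - s2) = 4 - s2 * s2 by ring.
by rewrite h; ring.
Qed.

Lemma omega2 : omega ^+ 2 = s2 / 2 * (1 + 'i).
Proof.
rewrite /omega -/s2 -/c -/d.
have h1 : c ^+ 2 = 2 + s2 by apply: sqrtCK.
have h2 : d ^+ 2 = 2 - s2 by apply: sqrtCK.
have -> : ((c + 'i * d) / 2) ^+ 2 = (c ^+ 2 + 'i ^+ 2 * d ^+ 2 + 2 * 'i * (c * d)) / 4 by field.
by rewrite h1 h2 cdE sqrCi; field.
Qed.

Lemma omega4 : omega ^+ 4 = 'i.
Proof.
have -> : omega ^+ 4 = (omega ^+ 2) ^+ 2 by rewrite -exprM.
rewrite omega2 expr2; have -> : s2 / 2 * (1 + 'i) * (s2 / 2 * (1 + 'i)) =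
  s2 ^+ 2 / 4 * (1 + 2 * 'i + 'i ^+ 2) :> algC by field.
by rewrite s2E sqrCi; field.
Qed.

Lemma omega8 : omega ^+ 8 = -1.
Proof.
have -> : omega ^+ 8 = (omega ^+ 4) ^+ 2 by rewrite -exprM.
by rewrite omega4 sqrCi.
Qed.

Lemma omega_neq0 : omega != 0.
Proof.
apply/eqP => h; have := omega8; rewrite h expr0n /= => /eqP.
by rewrite eq_sym oppr_eq0 oner_eq0.
Qed.

Lemma omega_conj : omega^* = omega^-1.
Proof.
apply: (mulfI omega_neq0); rewrite divff ?omega_neq0 //.
rewrite /omega -/s2 -/c -/d rmorphM rmorphD rmorphM /= conjCi.
have -> : (2^-1 : algC)^* = 2^-1 by rewrite conj_Creal // rpredV realn.
rewrite !conj_Creal ?ger0_real ?c_ge0 ?d_ge0 //.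
have h1 : c ^+ 2 = 2 + s2 by apply: sqrtCK.
have h2 : d ^+ 2 = 2 - s2 by apply: sqrtCK.
have -> : (c + 'i * d) / 2 * ((c + - 'i * d) / 2) = (c ^+ 2 - 'i ^+ 2 * d ^+ 2) / 4 by field.
by rewrite sqrCi h1 h2; field.
Qed.

Lemma omega_conjz (n : int) : (omega ^ n)^* = omega ^ (- n).
Proof. by rewrite fmorphXz /= omega_conj exprz_inv. Qed.

Lemma omega8z (n : int) : omega ^ (8 * n) = (-1) ^ n.
Proof. by rewrite -exprz_exp -[omega ^ 8]/(omega ^+ 8) omega8. Qed.

Lemma omega_b (n : int) (b : bool) : omega ^ (n + 8 * b%:Z) = (-1) ^+ b * omega ^ n.
Proof. by rewrite expfzDr ?omega_neq0 // omega8z mulrC. Qed.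

Lemma omega_16 (n m : int) : omega ^ (n + 16 * m) = omega ^ n.
Proof.
rewrite expfzDr ?omega_neq0 //.
have -> : 16 * m = 8 * (2 * m) by lia.
by rewrite omega8z -exprz_exp -[(-1) ^ 2]/((-1) ^+ 2) sqrrN expr1n exp1rz mulr1.
Qed.

Lemma xcrit_gt0 : 0 < xcrit.
Proof.
rewrite subr_gt0 -/s2 -(ltr_pXn2r (n := 2)) ?nnegrE ?ltW ?s2_gt0 ?ltr01 // s2E.
by rewrite expr1n ltr1n.
Qed.

Lemma Re_omega3 : 'Re (omega ^+ 3) = xcrit * 'Re omega.
Proof.
have E (z : algC) : 'Re z = (z + z^*) / 2 by rewrite ReE.
rewrite !E rmorphXn /= omega_conj -/s2.
have o3 : omega ^+ 2 * omega^-1 ^+ 2 = 1.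
  by rewrite -exprMn divff ?omega_neq0 ?expr1n.
have o1 : omega * omega^-1 = 1 by rewrite divff ?omega_neq0.
have s : omega ^+ 2 + omega^-1 ^+ 2 = s2.
  rewrite -omega_conj -rmorphXn /= omega2 rmorphM rmorphD /= conjCi rmorph1.
  rewrite (@conj_Creal _ (s2 / 2)); first by field.
  by rewrite rpredM ?rpredV ?realn // ger0_real // ltW ?s2_gt0.
have -> : omega ^+ 3 + omega^-1 ^+ 3 = (omega + omega^-1) * (omega ^+ 2 + omega^-1 ^+ 2 - omega * omega^-1) by ring.
by rewrite s o1 /xcrit -/s2; ring.
Qed.

End Omega.

Lemma eta_dirE (k : 'I_4) : eta_dir k = omega ^ (- (2 * (k%:Z + 1))).
Proof. by rewrite /eta_dir PoszD. Qed.

Section Weight.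
Variables (N M : nat) (V : {set vtx N M}) (sig : piece N M -> bool) (H : {set piece N M}).
Implicit Types (v w u : vtx N M) (k l : 'I_4) (p q x y e f : piece N M) (G L : {set piece N M}).
Hypothesis HV : forall p, p \in H -> p.1 \in V.
Hypothesis sigm : forall p, interior_half V p -> sig (mate p) = sig p.

Definition sheet_shift p := [&& interior_half V p, ~~ base p & sig p].

Lemma liftpE p s : liftp V sig p s = ((liftp V sig p false).1, s (+) sheet_shift p).
Proof.
rewrite /liftp /sheet_shift; case: (interior_half V p); case: (base p); rewrite //= addbF //.
Qed.

Lemma lonesetE x : (x \in loneset V H) = (x \in H) && (x \notin paired H).
Proof. by rewrite inE; case: (boolP (x \in H)) => //= xH; rewrite loneE. Qed.

Lemma signF (b : bool) : (if b then 1 else -1) = (-1) ^+ (~~ b) :> algC.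
Proof. by case: b. Qed.

Section Pairing.
Variable pr : piece N M -> piece N M.
Hypothesis prP : pairing H pr.

Lemma path_invariant_path pa s : pa \in H -> pa \notin paired H ->
  path (fun e e' => ~~ lone V H (pr e) && (e' == mate (pr e))) pa s ->
  path_invariant sig H pa pr (pathset pr (pa :: s)) (pr (last pa s)) (windcount pr (pa :: s))
    (odd (count (fun e => sig (pr e)) (belast pa s))).
Proof.
move=> paH paL; elim/last_ind: s => [|s e IH].
  move=> _; rewrite /windcount big_seq1 /=.
  have -> : pathset pr [:: pa] = [set pa; pr pa].
    by apply/setP => x; rewrite !inE.
  exact: path_invariant_base.
rewrite rcons_path => /andP[/IH I /andP[lq /eqP ee]].
have := path_invariant_step HV sigm prP paH paL I lq; rewrite -ee last_rcons.
have -> : pathset pr (pa :: rcons s e) = pr e |: (e |: pathset pr (pa :: s)).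
  apply/setP => x; rewrite !(in_setU1, in_set) -rcons_cons map_rcons !mem_rcons.
  rewrite [x \in e :: _]in_cons [x \in pr e :: _]in_cons.
  by do 2!case: (x == _) => //=; rewrite ?orbT.
have -> : windcount pr (pa :: rcons s e) = windcount pr (pa :: s) + turn e (pr e).
  by rewrite /windcount -rcons_cons -cats1 big_cat big_seq1.
rewrite belast_rcons lastI -cats1 count_cat /= addn0 oddD oddb //.
Qed.

End Pairing.

Variables a z : piece N M * bool.

Lemma dec_weight_path pr es zl :
  pairing H pr -> path_ok V H pr a.1 es ->
  loneset V H = [set a.1; zl] -> zl != a.1 -> (liftp V sig zl false).1 = z.1 ->
  'i * eta_dir a.1.2 * dec_weight V sig H pr a z es =
  (-1) ^+ (~~ (phase_parity a.1 zl H (+) xsum (paired_base H) sig (+) a.2 (+) z.2 (+) sheet_shift zl)) *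
    omega ^ (- (2 * (zl.2%:Z + 1))).
Proof.
move=> prP; case: es => [|e0 s] /=.
  by move=> aH /setP /(_ a.1); rewrite lonesetE (negbTE aH) !inE eqxx.
case=> -> aH chain lq lH nz lz.
have aL : a.1 \notin paired H.
  by move/setP/(_ a.1): lH; rewrite lonesetE aH !inE eqxx.
have zH : (zl \in H) /\ (zl \notin paired H).
  by apply/andP; rewrite -lonesetE lH !inE eqxx orbT.
have pth : path (fun e e' => ~~ lone V H (pr e) && (e' == mate (pr e))) a.1 s.
  apply/(pathP a.1) => i ilt; have [h1 h2] := chain i ilt.
  by rewrite h1 /= h2.
have I := path_invariant_path prP aH aL pth.
set G := pathset _ _ in I; set q := pr (last a.1 s) in I lq *.
have qH := subsetP (pi_sub I) _ (pi_q I).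
have qz : q = zl.
  rewrite (loneE HV qH) in lq.
  have : q \in loneset V H by rewrite lonesetE qH.
  by rewrite lH !inE (negbTE (pi_neq I)) => /eqP.
rewrite qz in I lq.
have hl x : x \in H -> x \notin paired H -> x = a.1 \/ x = zl.
  move=> xH xF; have : x \in loneset V H by rewrite lonesetE xH.
  by rewrite lH !inE => /orP[] /eqP; [left|right].
have FL := paired_rest I aL zH.2 hl.
have cL := pr_compl prP (pi_sub I) (pi_pr I).
rewrite /dec_weight -signr_odd (nodd_parity sig HV prP cL FL).
have tk : take (size (a.1 :: s)).-1 (a.1 :: s) = belast a.1 s.
  by rewrite /= [X in take _ X]lastI -cats1 take_size_cat // size_belast.
rewrite /endlift tk /= -/q qz liftpE lz.
rewrite {2}[z]surjective_pairing xpair_eqE eqxx /= signF.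
rewrite (pi_s I) (phase_parity_rest prP I aL zH.2 hl) (xsum_base_rest I aL zH.2 hl).
have [m em] := pi_w I.
have key : 'i * eta_dir a.1.2 * omega ^ (- (2 * windcount pr (a.1 :: s))) =
    (-1) ^+ (~~ phase_parity a.1 zl G) * omega ^ (- (2 * (zl.2%:Z + 1))).
  rewrite -omega4 eta_dirE -[omega ^+ 4]/(omega ^ 4) -!expfzDr ?omega_neq0 //.
  rewrite -omega_b -[in RHS](omega_16 _ (- m)) em; congr (_ ^ _).
  by case: (phase_parity _ _ _) => /=; clear; move: (nat_of_ord zl.2) (nat_of_ord a.1.2) => d k; lia.
rewrite !mulrA key 2!(mulrAC _ (omega ^ _)) -!signr_addb; congr (_ * _); congr (_ ^+ _); congr nat_of_bool.
case: (phase_parity _ _ _); case: (xsum (paired_base G) sig); case: (xsum (paired_base _) sig); case: (a.2); case: (z.2);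
  by case: (sheet_shift zl).
Qed.

Lemma dec_weight_loop pr es :
  pairing H pr -> path_ok V H pr a.1 es -> a.1 \notin H ->
  loneset V H = set0 -> z.1 = a.1 ->
  dec_weight V sig H pr a z es = (-1) ^+ (xsum (paired_base H) sig (+) a.2 (+) z.2).
Proof.
move=> prP; case: es => [|e0 s] /=; last by case=> _ aH _ _; rewrite aH.
move=> _ aH l0 za.
have p0 : H :\: pathset pr [::] = H.
  by apply/setP => x; rewrite !inE.
have FL : paired (H :\: pathset pr [::]) = H :\: pathset pr [::].
  rewrite p0; apply/setP => x; rewrite in_paired; case: (boolP (x \in H)) => //= xH.
  move/setP/(_ x): l0; rewrite lonesetE xH in_set0 /= => /negbFE.
  by rewrite in_paired xH.
have cL : {in H :\: pathset pr [::], forall x, pr x \in H :\: pathset pr [::]}.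
  by rewrite p0; apply: (prH prP).
rewrite /dec_weight -signr_odd (nodd_parity sig HV prP cL FL) p0 /endlift.
rewrite /windcount big_nil mulr0 oppr0 expr0z mul1r.
rewrite {1}[a]surjective_pairing {1}[z]surjective_pairing xpair_eqE za eqxx /= signF.
rewrite -signr_addb; congr (_ ^+ _); congr nat_of_bool.
by case: (xsum _ _); case: (a.2); case: (z.2).
Qed.

End Weight.

Section Conf.
Variables (N M : nat) (V : {set vtx N M}) (sig : piece N M -> bool) (pa : piece N M).
Implicit Types (v w u : vtx N M) (k l : 'I_4) (p q x y e f : piece N M) (H R S T : {set piece N M}).
Hypothesis Ba : boundary V pa.

Lemma boundaryE p : boundary V p = (p.1 \in V) && ~~ interior_half V p.
Proof.
rewrite /boundary /interior_half; case: (p.1 \in V) => //=.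
by case: nbr.
Qed.

Lemma interior_neq p : interior_half V p -> mate p != p.
Proof.
rewrite /interior_half => /andP[_]; rewrite /mate; case e: nbr => [w|//] _.
by apply: contraNneq (nbr_neq e) => /(congr1 fst) /= ->.
Qed.

Lemma interior_mate p : interior_half V p -> interior_half V (mate p).
Proof.
move=> ip; have [e1 e2] := mateE (interior_neq ip).
move: ip; rewrite /interior_half e1 => /andP[pV mV]; rewrite mV /=.
by rewrite e2 (nbr_opp e1).
Qed.

Lemma boundary_interiorF : interior_half V pa = false.
Proof. by move: Ba; rewrite boundaryE => /andP[_ /negbTE]. Qed.

Lemma boundary_vtx : pa.1 \in V. Proof. by move: Ba; rewrite boundaryE => /andP[]. Qed.

Lemma mate_boundaryF x : interior_half V x -> (mate x == pa) = false.
Proof. by move=> /interior_mate h; apply: contraTF h => /eqP ->; rewrite boundary_interiorF. Qed.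

Lemma interior_mate_boundaryF x : interior_half V x && (mate x == pa) = false.
Proof. by case: (boolP (interior_half V x)) => //= /mate_boundaryF. Qed.

Definition edge_odd H x := (x \in H) (+) (interior_half V x && (mate x \in H)).
Definition edge_char p x := (x == p) (+) (interior_half V x && (mate x == p)).

(* The condition on lone pieces in [conf], made linear over F_2 so that it is
   stable under toggling. *)
Record parity_conf p H : Prop := ParityConf {
  parity_conf_vtx : forall x, x \in H -> x.1 \in V;
  parity_conf_even : even_deg H;
  parity_conf_odd : forall x, x.1 \in V -> edge_odd H x = (x == pa) (+) edge_char p x }.

Definition canon_piece p : piece N M := (liftp V sig p false).1.

Lemma canon_pieceE p : canon_piece p = if interior_half V p && ~~ base p then mate p else p.
Proof. by rewrite /canon_piece /liftp; case: ifP. Qed.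

Lemma canon_piece_mate p : interior_half V p -> canon_piece (mate p) = canon_piece p.
Proof.
move=> ip; rewrite !canon_pieceE ip interior_mate // base_mate ?interior_neq // negbK mateK.
by case: (base p).
Qed.

Lemma edge_odd_lone H x : (forall x, x \in H -> x.1 \in V) -> x \in H ->
  (x \in loneset V H) = edge_odd H x.
Proof.
move=> HV xH; rewrite inE xH /= /lone /edge_odd xH /=.
by case: (_ && _).
Qed.

Lemma edge_odd_loneset H x : (forall x, x \in H -> x.1 \in V) ->
  edge_odd H x = (x \in loneset V H) || (interior_half V x && (mate x \in loneset V H)).
Proof.
move=> HV; rewrite !inE /lone /edge_odd mateK; case: (boolP (interior_half V x)) => ix /=; last first.
  by rewrite andbT orbF addbF andbb.
rewrite interior_mate //=.
by case: (x \in H); case: (mate x \in H).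
Qed.

Lemma parity_conf_loop H : parity_conf pa H -> loneset V H = set0.
Proof.
move=> c; apply/setP => x; rewrite in_set0; apply/negP => xl.
have xH : x \in H by move: xl; rewrite inE => /andP[].
have := edge_odd_lone (parity_conf_vtx c) xH; rewrite xl (parity_conf_odd c) ?(parity_conf_vtx c) // /edge_char interior_mate_boundaryF.
by case: (x == pa).
Qed.

Definition path_end p H := if p \in H then p else mate p.

Lemma parity_conf_lone p H : p.1 \in V -> p != pa -> parity_conf p H ->
  [/\ path_end p H \in H, path_end p H != pa, loneset V H = [set pa; path_end p H],
      pa \in H & p \in H \/ interior_half V p].
Proof.
move=> pV npa c; have HV := parity_conf_vtx c.
have odp : edge_odd H p = true.
  rewrite (parity_conf_odd c) // (negbTE npa) /edge_char eqxx /=.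
  by case: (boolP (interior_half V p)) => //= /interior_neq/negbTE ->.
have paH : pa \in H.
  have := parity_conf_odd c boundary_vtx; rewrite eqxx /edge_odd /edge_char boundary_interiorF /= addbF => ->.
  by rewrite eq_sym (negbTE npa).
have paL : pa \in loneset V H.
  by rewrite edge_odd_lone // (parity_conf_odd c) ?boundary_vtx // /edge_char boundary_interiorF eqxx eq_sym (negbTE npa).
have lon x : x \in loneset V H -> [|| x == pa, x == p | interior_half V x && (mate x == p)].
  move=> xl; have xH : x \in H by move: xl; rewrite inE => /andP[].
  move: xl; rewrite edge_odd_lone // (parity_conf_odd c) ?HV // /edge_char.
  by case: (x == pa); case: (x == p); case: (_ && _).
rewrite /path_end; case: (boolP (p \in H)) => pH.
  have pL : p \in loneset V H by rewrite edge_odd_lone.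
  split=> //; last by left.
  apply/setP => x; rewrite !in_set2; apply/idP/idP => [xl|/orP[] /eqP -> //].
  have /or3P[->//|->//|] := lon _ xl; first by rewrite orbT.
  rewrite mate_eq => /andP[ix /eqP ex]; move: pL; rewrite inE /lone pH /=.
  move: xl ix; rewrite ex inE => /andP[mH _] /interior_mate; rewrite mateK => ->.
  by rewrite mH.
move: odp; rewrite /edge_odd (negbTE pH) /= => /andP[ip mH].
have mL : mate p \in loneset V H.
  by rewrite edge_odd_lone // /edge_odd mH mateK (negbTE pH) andbF.
split=> //; [by rewrite mate_boundaryF | | by right].
apply/setP => x; rewrite !in_set2; apply/idP/idP => [xl|/orP[] /eqP -> //].
have /or3P[->//|/eqP ex|] := lon _ xl.
  by move: xl; rewrite ex inE (negbTE pH).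
by rewrite mate_eq => /andP[_ ->]; rewrite orbT.
Qed.

Lemma deg_even H : reflect (even_deg H) [forall v, deg H v \in [:: 0; 2; 4]%N].
Proof.
apply: (iffP forallP) => h v.
  by rewrite -odd_card; have := h v; rewrite /deg !inE => /or3P[] /eqP ->.
have := h v; rewrite -odd_card -/(deg H v); have := deg_le H v.
by case: (deg H v) => [|[|[|[|[|n]]]]].
Qed.

Lemma conf_of_parity p H : p.1 \in V -> parity_conf p H -> conf V pa (canon_piece p) H.
Proof.
move=> pV c; have HV := parity_conf_vtx c; apply/and3P; split.
- by apply/forallP => x; apply/implyP; apply: HV.
- by apply/deg_even; apply: parity_conf_even c.
have [ep|np] := eqVneq p pa.
  by subst p; rewrite canon_pieceE boundary_interiorF /= eqxx parity_conf_loop.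
have [_ _ -> _ h] := parity_conf_lone pV np c.
have -> : canon_piece p == pa = false.
  by rewrite canon_pieceE; case: ifP => [/andP[ip _]|_]; [apply: mate_boundaryF | apply: negbTE].
rewrite canon_pieceE boundaryE /path_end.
case: (boolP (interior_half V p)) h => ip h /=; last first.
  by rewrite pV ip /=; case: h => // ->.
case: (base p) => /=.
  by rewrite ip andbF; case: ifP; rewrite eqxx ?orbT.
by rewrite interior_mate // andbF mateK; case: ifP; rewrite eqxx ?orbT.
Qed.

Lemma parity_of_conf p H : p.1 \in V -> conf V pa (canon_piece p) H -> parity_conf p H.
Proof.
move=> pV /and3P[/forallP HV' /deg_even ev lo].
have HV x : x \in H -> x.1 \in V by move=> xH; have /implyP := HV' x; apply.
split=> // x xV; rewrite edge_odd_loneset //.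
have [ep|np] := eqVneq p pa.
  subst p; move: lo; rewrite canon_pieceE boundary_interiorF /= eqxx => /eqP ->.
  rewrite !in_set0 andbF /edge_char interior_mate_boundaryF.
  by case: (x == pa).
have [z ez hz] : exists2 z, loneset V H = [set pa; z] & z = p \/ interior_half V p /\ z = mate p.
  move: lo; have -> : canon_piece p == pa = false.
    by rewrite canon_pieceE; case: ifP => [/andP[ip _]|_]; [apply: mate_boundaryF | apply: negbTE].
  rewrite canon_pieceE boundaryE; case: (boolP (interior_half V p)) => ip /=; last first.
    by rewrite pV ip /= => /eqP ->; exists p => //; left.
  case: (base p) => /=.
    rewrite ip andbF => /orP[] /eqP ->; first by exists p; [|left].
    by exists (mate p); [|right].
  rewrite interior_mate // andbF mateK => /orP[] /eqP ->; last by exists p; [|left].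
  by exists (mate p); [|right].
have mm y : interior_half V y && ((mate y == pa) || (mate y == z)) =
    interior_half V y && (mate y == z).
  by case: (boolP (interior_half V y)) => //= iy; rewrite mate_boundaryF.
rewrite ez !in_set2 mm /edge_char; have npa : pa == p = false by rewrite eq_sym (negbTE np).
case: hz => [->|[ip ->]].
  have [->|nx] := eqVneq x pa; first by rewrite boundary_interiorF npa.
  have [->|//] := eqVneq x p.
  by case: (boolP (interior_half V p)) => //= /interior_neq/negbTE ->.
rewrite (inj_eq (@mate_inj N M)).
have [->|nx] := eqVneq x pa; first by rewrite boundary_interiorF npa.
rewrite -mate_eq; have [->|nx'] := eqVneq x p.
  by rewrite ip; case: (mate p == p) (interior_neq ip).
have [e|_] := eqVneq (mate x) p; rewrite ?andbF //=.
by move: ip; rewrite -e => /interior_mate; rewrite mateK => ->.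
Qed.

End Conf.

(* Sign and exponent of x in the value of Re (omega^(2 (k - d) + 1)). *)
Definition re_sign (k d : nat) : bool := [|| k == d + 2, k == d + 3 | d == k + 3]%N.
Definition re_exp (k d : nat) : bool := [|| d == k + 3, d == k + 2, k == d + 1 | k == d + 2]%N.

Lemma Re_omegaN n : 'Re (omega ^ (- n)) = 'Re (omega ^ n).
Proof. by rewrite -omega_conjz !ReE conjCK addrC. Qed.

Lemma Re_omega_3 : 'Re (omega ^ (3 : int)) = xcrit * 'Re omega.
Proof. exact: Re_omega3. Qed.

Lemma Re_omega_add8 (n : int) : 'Re (omega ^ (n + 8)) = - 'Re (omega ^ n).
Proof.
have -> : n + 8 = n + 8 * (true%:Z) by lia.
by rewrite omega_b expr1 mulN1r raddfN.
Qed.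

Lemma Re_omega_5 : 'Re (omega ^ (5 : int)) = - (xcrit * 'Re omega).
Proof. by rewrite (_ : 5 = - (3 : int) + 8) // Re_omega_add8 Re_omegaN Re_omega_3. Qed.

Lemma Re_omega_7 : 'Re (omega ^ (7 : int)) = - 'Re omega.
Proof. by rewrite (_ : 7 = - (1 : int) + 8) // Re_omega_add8 Re_omegaN. Qed.

Lemma Re_omega_table (k d : 'I_4) :
  'Re (omega ^ (2 * k%:Z + 3 - 2 * (d%:Z + 1))) =
  (-1) ^+ re_sign k d * xcrit ^+ re_exp k d * 'Re omega.
Proof.
have r3 := Re_omega_3; have r5 := Re_omega_5; have r7 := Re_omega_7.
have r3' : 'Re (omega ^ (-3 : int)) = xcrit * 'Re omega by rewrite Re_omegaN.
have r5' : 'Re (omega ^ (-5 : int)) = - (xcrit * 'Re omega) by rewrite Re_omegaN.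
have r1 : 'Re (omega ^ (1 : int)) = 'Re omega by [].
have r1' : 'Re (omega ^ (-1 : int)) = 'Re omega by rewrite Re_omegaN.
case: k => [[|[|[|[|k]]]] lk] //; case: d => [[|[|[|[|d]]]] ld] //;
rewrite /re_sign /re_exp /= ?expr0 ?expr1 ?mul1r ?mulr1 ?mulN1r ?mulNr.
- exact: r1. - exact: r1'. - exact: r3'. - exact: r5'.
- exact: r3. - exact: r1. - exact: r1'. - exact: r3'.
- exact: r5. - exact: r3. - exact: r1. - exact: r1'.
- exact: r7. - exact: r5. - exact: r3. - exact: r1.
Qed.

Lemma eta_cornerE (k : 'I_4) : eta_corner k = omega ^ (- (2 * k%:Z + 3)).
Proof. by []. Qed.

Section Term.
Variables (N M : nat) (V : {set vtx N M}) (sig : piece N M -> bool) (a : piece N M * bool).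
Implicit Types (v w u : vtx N M) (k l : 'I_4) (p q x y e f : piece N M) (H R S T : {set piece N M}).
Hypothesis Ba : boundary V a.1.
Hypothesis sigm : forall p, interior_half V p -> sig (mate p) = sig p.
Notation pa := a.1.

Lemma Wt_spec z H : (exists pr es, pairing H pr /\ path_ok V H pr pa es) ->
  exists pr es, [/\ pairing H pr, path_ok V H pr pa es & Wt V sig a z H = dec_weight V sig H pr a z es].
Proof.
move=> [pr [es [h1 h2]]]; rewrite /Wt; set P := (P in epsilon _ P).
have : exists c, P c by exists (dec_weight V sig H pr a z es); exists pr; exists es.
exact: epsilon_spec.
Qed.

Lemma start_notin H : parity_conf V pa pa H -> pa \notin H.
Proof.
move=> c; have := parity_conf_odd c (boundary_vtx Ba); rewrite /edge_odd /edge_char (boundary_interiorF Ba) eqxx /= addbF.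
by move=> ->.
Qed.

Lemma Wt_exists p H : p.1 \in V -> parity_conf V pa p H ->
  exists pr es, pairing H pr /\ path_ok V H pr pa es.
Proof.
move=> pV c; have HV := parity_conf_vtx c; have /deg_even/forallP dH := parity_conf_even c.
have prP := greedy_pairingP dH; exists (greedy_pairing H).
have [ep|np] := eqVneq p pa.
  by exists [::]; split=> //; apply: start_notin; rewrite -{2}ep.
have [_ _ lH paH _] := parity_conf_lone Ba pV np c.
have paL : pa \notin paired H.
  by move/setP/(_ pa): lH; rewrite (lonesetE HV) paH in_set2 eqxx.
by have [es h] := path_exists HV prP paH paL; exists es.
Qed.

Lemma canon_piece_tip p H : parity_conf V pa p H -> p.1 \in V -> p != pa ->
    canon_piece V sig (path_end p H) = canon_piece V sig p.
Proof.
move=> c pV np; have [_ _ _ _ h] := parity_conf_lone Ba pV np c; rewrite /path_end.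
by case: ifP h => // _ [//|ip]; apply: canon_piece_mate.
Qed.

Lemma Wt_path p s H : p.1 \in V -> p != pa -> parity_conf V pa p H ->
  'i * eta_dir pa.2 * Wt V sig a (liftp V sig p s) H =
  (-1) ^+ (~~ (phase_parity pa (path_end p H) H (+) xsum (paired_base H) sig (+) a.2 (+)
    (s (+) sheet_shift V sig p) (+) sheet_shift V sig (path_end p H))) *
    omega ^ (- (2 * ((path_end p H).2%:Z + 1))).
Proof.
move=> pV np c; have [pr [es [h1 h2 ->]]] := Wt_spec (liftp V sig p s) (Wt_exists pV c).
have [_ nz lH _ _] := parity_conf_lone Ba pV np c.
rewrite (dec_weight_path (parity_conf_vtx c) sigm h1 h2 lH nz) //; last first.
  by rewrite [liftp _ _ p s]liftpE /= -/(canon_piece V sig _) canon_piece_tip.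
by rewrite [liftp _ _ p s]liftpE.
Qed.

Lemma Wt_loop s H : parity_conf V pa pa H ->
  Wt V sig a (liftp V sig pa s) H = (-1) ^+ (xsum (paired_base H) sig (+) a.2 (+) s).
Proof.
move=> c; have [pr [es [h1 h2 ->]]] := Wt_spec (liftp V sig pa s) (Wt_exists (boundary_vtx Ba) c).
rewrite (dec_weight_loop sig (parity_conf_vtx c) h1 h2) ?start_notin ?(parity_conf_loop Ba c) //;
  by rewrite /liftp (boundary_interiorF Ba).
Qed.

Lemma card_paired H : #|paired H| = (#|paired_base H|).*2.
Proof.
have D : [disjoint paired_base H & [set mate x | x in paired_base H]].
  apply/pred0P => x /=; apply/andP => -[h /imsetP[y hy e]]; move: h hy.
  by rewrite e !in_paired_base => /and4P[_ _ h b] /and4P[_ _ h' b']; rewrite base_mate // b' in b.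
have -> : paired H = paired_base H :|: [set mate x | x in paired_base H].
  apply/setP => x; rewrite in_setU in_paired_base in_paired.
  have -> : (x \in [set mate x | x in paired_base H]) = (mate x \in paired_base H).
    apply/imsetP/idP => [[y hy ->]|h]; first by rewrite mateK.
    by exists (mate x); rewrite ?mateK.
  rewrite in_paired_base mateK eq_sym [x == _]eq_sym.
  case: (x \in H); case: (mate x \in H) => //=.
  by case: (boolP (mate x == x)) => //= h; rewrite base_mate // orbN.
rewrite cardsU disjoint_setI0 // cards0 subn0 card_imset ?addnn //; exact: mate_inj.
Qed.

Lemma xweightE H : (forall x, x \in H -> x.1 \in V) ->
  xweight V H = xcrit ^+ #|paired_base H| * sqrtC xcrit ^+ #|loneset V H|.
Proof.
move=> HV; rewrite /xweight /nfull; congr (_ ^+ _ * _).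
have -> : loneset V H = H :\: paired H.
  by apply/setP => x; rewrite (lonesetE HV) in_setD andbC.
have sF : paired H \subset H by apply/subsetP => x; rewrite in_paired => /and3P[].
rewrite cardsDS // subKn; last exact: subset_leq_card.
by rewrite card_paired doubleK.
Qed.

Variable k : 'I_4.
Definition corner_term p s H : algC :=
  'Re ((eta_corner k)^* * ('i * eta_dir pa.2 * (Wt V sig a (liftp V sig p s) H * xweight V H))).

Lemma xcrit_real n : xcrit ^+ n \is Num.real.
Proof. by rewrite rpredX // gtr0_real // xcrit_gt0. Qed.

Lemma sign_real (b : bool) : (-1) ^+ b \is @Num.real algC.
Proof. by rewrite rpredX // rpredN1. Qed.

Lemma corner_term_path p s H : p.1 \in V -> p != pa -> parity_conf V pa p H ->
  corner_term p s H =
  (-1) ^+ (~~ (phase_parity pa (path_end p H) H (+) xsum (paired_base H) sig (+) a.2 (+)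
    (s (+) sheet_shift V sig p) (+) sheet_shift V sig (path_end p H)) (+)
    re_sign k (path_end p H).2) *
  xcrit ^+ (#|paired_base H| + 1 + re_exp k (path_end p H).2) * 'Re omega.
Proof.
move=> pV np c; have [_ nz lH _ _] := parity_conf_lone Ba pV np c.
rewrite /corner_term [_ * (_ * xweight _ _)]mulrA Wt_path // xweightE; last exact: parity_conf_vtx c.
have -> : sqrtC xcrit ^+ #|loneset V H| = xcrit ^+ 1.
  by rewrite lH cards2 eq_sym nz /= sqrtCK expr1.
rewrite -exprD eta_cornerE omega_conjz opprK.
set b := ~~ _; set n := addn _ 1; set A := omega ^ _; set B := omega ^ _.
rewrite [_ * B * _]mulrAC [A * _]mulrCA.
rewrite -expfzDr ?omega_neq0 // ReMl ?rpredM ?sign_real ?xcrit_real //.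
by rewrite Re_omega_table signr_addb exprD mulrA mulrACA.
Qed.

Lemma corner_term_loop p s H : p = pa -> pa.2 = k \/ pa.2 = ordS k -> parity_conf V pa p H ->
  corner_term p s H =
  (-1) ^+ (xsum (paired_base H) sig (+) a.2 (+) s (+) ((pa.2 == k) || (val k == 3%N))) *
     xcrit ^+ (#|paired_base H| + 1) * 'Re omega.
Proof.
move=> -> ka c; rewrite /corner_term Wt_loop // xweightE; last exact: parity_conf_vtx c.
rewrite (parity_conf_loop Ba c) cards0 expr0 mulr1 eta_cornerE omega_conjz opprK.
rewrite -omega4 eta_dirE -[omega ^+ 4]/(omega ^ 4) -expfzDr ?omega_neq0 //.
set b := _ (+) s; set n := #|_|; set A := omega ^ _; set B := omega ^ _.
rewrite mulrA mulrC.
rewrite -expfzDr ?omega_neq0 // ReMl ?rpredM ?sign_real ?xcrit_real //.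
rewrite signr_addb exprD expr1 -!mulrA; congr (_ * _).
rewrite [RHS]mulrCA; congr (_ * _).
have r3 := Re_omega_3; have r5 := Re_omega_5.
have r11 : 'Re (omega ^ (11 : int)) = - (xcrit * 'Re omega).
  by rewrite (_ : 11 = (3 : int) + 8) // Re_omega_add8 Re_omega_3.
case: ka => ->.
  rewrite eqxx /= expr1 mulN1r -r5; congr ('Re (_ ^ _)).
  by move: (nat_of_ord k) => d; lia.
case: (k) => [[|[|[|[|d]]]] ld] //=; rewrite ?expr0 ?mul1r ?expr1 ?mulN1r.
- exact: r3. - exact: r3. - exact: r3. - exact: r11.
Qed.

End Term.

(** * The bijection at a corner *)

Section Main.
Variables (N M : nat) (V : {set vtx N M}) (sig : piece N M -> bool) (a : piece N M * bool).
Implicit Types (v w u : vtx N M) (k l : 'I_4) (p q x y e f : piece N M) (H R S T : {set piece N M}).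
Hypothesis Ba : boundary V a.1.
Hypothesis sigm : forall p, interior_half V p -> sig (mate p) = sig p.
Notation pa := a.1.
Variables (v : vtx N M) (k : 'I_4).
Hypothesis vV : v \in V.

Definition corner p q := [/\ p.1 = v, q.1 = v &
  (p.2 = k /\ q.2 = ordS k) \/ (p.2 = ordS k /\ q.2 = k)].

Lemma cornerC p q : corner p q -> corner q p.
Proof. by case=> h1 h2 [[]|[]] h3 h4; split=> //; [right|left]. Qed.

Lemma ordS_neq : ordS k != k.
Proof. by case: (k) => [[|[|[|[|d]]]] ld]. Qed.

Lemma corner_neq p q : corner p q -> p != q.
Proof.
case=> _ _ h; apply: contraNneq ordS_neq => e.
by case: h => -[<- <-]; rewrite e.
Qed.

Lemma corner_adj p q : corner p q -> forall x,
  prec p x (+) prec q x = (x == (v, ordS k)) (+) ((val k == 3%N) && (x.1 == v)).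
Proof.
case: p => [w d]; case: q => [w' d'] [/= -> -> h] [u e].
have [->|nu] := eqVneq u v; last first.
  by rewrite xpair_eqE (negbTE nu) /= andbF !prec_vtx /= 1?eq_sym // addbb.
rewrite !prec_dir // xpair_eqE eqxx /= andbT.
have -> : (e == ordS k) = (val e == (k.+1 %% 4)%N) by [].
case: h => -[-> ->] /=; case: (k) => [[|[|[|[|c]]]] lc] //;
  by case: e => [[|[|[|[|e]]]] le].
Qed.

Lemma corner_last p q : corner p q -> (v, ordS k) = p \/ (v, ordS k) = q.
Proof.
by case: p => [w d]; case: q => [w' d'] [/= -> -> [[-> ->]|[-> ->]]]; [right|left].
Qed.

Lemma mate_corner p q : corner p q -> mate p != q.
Proof.
move=> c; have [h1 h2 _] := c; have [e|n] := eqVneq (mate p) p.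
  by rewrite e; apply: corner_neq c.
by apply: contraNneq (mate_vtx n) => ->; rewrite h1 h2.
Qed.

Lemma corner_prec p q : corner p q -> mate q != q -> prec p (mate q) = base q.
Proof.
case=> h1 h2 _ mq; rewrite -prec_mate // !prec_vtx ?h1 ?h2 //;
  by rewrite -h2 eq_sym mate_vtx.
Qed.

Lemma corner_prec_mate p q : corner p q -> mate q != q -> prec (mate q) p = ~~ base q.
Proof.
move=> c mq; rewrite -(corner_prec c mq); apply: precC.
by rewrite eq_sym mate_corner //; apply: cornerC.
Qed.

Lemma parity_conf_symdiff p q H : corner p q -> parity_conf V pa p H ->
    parity_conf V pa q (symdiff H [set p; q]).
Proof.
move=> c [HV ev ho]; have [pv qv _] := c; have npq := corner_neq c.
have i2 x : (x \in [set p; q]) = (x == p) (+) (x == q).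
  rewrite in_set2; have [->|//] := eqVneq x p.
  by rewrite (negbTE npq).
split.
- move=> x; rewrite in_symdiff in_set2; case: (boolP (x \in H)) => [/HV //|_].
  by case/orP => /eqP ->; rewrite ?pv ?qv.
- by move=> w; rewrite xsum_symdiff ev xsumU1 ?in_set1 // xsum1 pv qv addbb.
- move=> x xV; have := ho x xV; rewrite /edge_odd /edge_char !in_symdiff !i2.
  case: (x \in H); case: (mate x \in H); case: (interior_half V x);
  case: (x == p); case: (x == q); case: (mate x == p); case: (mate x == q); by case: (x == pa).
Qed.

Lemma symdiffK H D : symdiff (symdiff H D) D = H :> {set piece N M}.
Proof. by apply/setP => x; rewrite !in_symdiff addbK. Qed.

Notation corner_term := (corner_term V sig a k).

Lemma corner_dirs p q : corner p q ->
  [/\ re_sign k p.2 = (val p.2 == 0%N) && (val k == 3%N) & re_exp k p.2 = false].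
Proof.
case=> _ _ h; rewrite /re_sign /re_exp; case: p q h => [w d] [w' d'] /= [[-> _]|[-> _]];
  by case: (k) => [[|[|[|[|c]]]] lc].
Qed.

Lemma sig_base_half q : interior_half V q -> sig (base_half q) = sig q.
Proof. by rewrite /base_half; case: ifP => // _; apply: sigm. Qed.

Lemma sheet_shift_mate q : interior_half V q ->
    sheet_shift V sig q (+) sheet_shift V sig (mate q) = sig q.
Proof.
move=> iq; have mq := interior_neq iq; have imq := interior_mate iq.
by rewrite /sheet_shift (sigm iq) (base_mate mq) iq imq; case: (base q); case: (sig q).
Qed.

Lemma paired_base_lone q H : q \notin H -> mate q \notin H ->
    paired_base (q |: H) = paired_base H.
Proof. by move=> h1 h2; rewrite /paired_base paired_lone. Qed.

Lemma lone_mate (K R : {set piece N M}) y : (forall x, x \in K -> x.1 \in V) ->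
  y \in loneset V K -> K = y |: R -> y \notin R -> mate y \notin R.
Proof.
move=> KV yL eK yR; apply/negP => h; move: yL; rewrite (lonesetE KV) in_paired.
have [e|_] := eqVneq (mate y) y; first by rewrite e (negbTE yR) in h.
have -> : mate y \in K by rewrite eK in_setU1 h orbT.
by rewrite andbT andbN.
Qed.

Lemma corner_term_near_near p q s H : corner p q -> p != pa -> q != pa -> parity_conf V pa p H ->
  p \in H -> q \notin H -> corner_term p s H = corner_term q s (symdiff H [set p; q]).
Proof.
move=> c np nq cH pH qH; have c' := parity_conf_symdiff c cH; have npq := corner_neq c.
have [pv qv _] := c.
have pV : p.1 \in V by rewrite pv. have qV : q.1 \in V by rewrite qv.
set H' := symdiff _ _ in c' *.
have qH' : q \in H' by rewrite in_symdiff in_set2 eqxx orbT (negbTE qH).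
rewrite (corner_term_path Ba sigm _ _ _ np cH) // (corner_term_path Ba sigm _ _ _ nq c') //.
rewrite /path_end pH qH'.
have [_ _ lH _ _] := parity_conf_lone Ba pV np cH; rewrite /path_end pH in lH.
have [_ _ lH' _ _] := parity_conf_lone Ba qV nq c'; rewrite /path_end qH' in lH'.
pose R := H :\ p.
have eH : H = p |: R by rewrite setD1K.
have eH' : H' = q |: R.
  apply/setP => x; rewrite !(in_symdiff, inE).
  have [->|_] := eqVneq x q; first by rewrite (negbTE qH) orbT.
  by have [->|_] := eqVneq x p; rewrite ?pH // addbF.
have pR : p \notin R by rewrite !inE eqxx.
have qR : q \notin R by rewrite !inE (negbTE qH) andbF.
have mpR : mate p \notin R by apply: (lone_mate (parity_conf_vtx cH)) eH pR; rewrite lH in_set2 eqxx orbT.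
have mqR : mate q \notin R by apply: (lone_mate (parity_conf_vtx c')) eH' qR; rewrite lH' in_set2 eqxx orbT.
have I := phase_parity_near_near (corner_adj c) (corner_last c) pa pR qR mpR mqR.
have eR : xsum R (fun x => x.1 == v) = true.
  have := parity_conf_even cH v; rewrite eH xsumU1 // pv eqxx.
  by case: (xsum _ _).
rewrite eR andbT in I.
rewrite eH eH' !paired_base_lone //.
have [-> ->] := corner_dirs c; have [-> ->] := corner_dirs (cornerC c).
congr (_ ^+ _ * _ * _); congr nat_of_bool; move: I.
have : ((val q.2 == 0%N) && (val k == 3%N)) = ((val p.2 == 0%N) && (val k == 3%N)) (+) (val k == 3%N).
  case: c => _ _ [[-> ->]|[-> ->]]; by case: (k) => [[|[|[|[|d]]]] ld].
move=> -> <-.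
move: (phase_parity _ _ _) (phase_parity _ _ _) (xsum _ sig) (sheet_shift V sig p) (sheet_shift V sig q) (a.2) (_ && _).
by move=> b1 b2 b3 b4 b5 b6 b7; xor_tauto.
Qed.


Lemma corner_term_near_far p q s H : corner p q -> p != pa -> q != pa -> parity_conf V pa p H ->
  p \in H -> q \in H -> corner_term p s H = corner_term q s (symdiff H [set p; q]).
Proof.
move=> c np nq cH pH qH; have c' := parity_conf_symdiff c cH; have npq := corner_neq c.
have [pv qv _] := c.
have pV : p.1 \in V by rewrite pv. have qV : q.1 \in V by rewrite qv.
set H' := symdiff _ _ in c' *.
have qH' : q \in H' = false by rewrite in_symdiff in_set2 eqxx orbT qH.
rewrite (corner_term_path Ba sigm _ _ _ np cH) // (corner_term_path Ba sigm _ _ _ nq c') //.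
rewrite /path_end pH qH'.
have [_ _ lH paH _] := parity_conf_lone Ba pV np cH; rewrite /path_end pH in lH.
have [mqH' nmq lH' paH' hq] := parity_conf_lone Ba qV nq c'; rewrite /path_end qH' in mqH' nmq lH'.
have iq : interior_half V q by case: hq; rewrite ?qH'.
have mqq := interior_neq iq.
pose S := H' :\ mate q.
have eH' : H' = mate q |: S by rewrite setD1K.
have eH : H = p |: (q |: H').
  apply/setP => x; rewrite !(in_symdiff, in_setU1, in_set1).
  have [->|_] := eqVneq x p; first by rewrite pH.
  by have [->|_] := eqVneq x q; rewrite ?qH /= ?addbF ?orbT.
have pR : p \notin H' by rewrite in_symdiff in_set2 eqxx pH.
have qR : q \notin H' by rewrite qH'.
have pU : p \notin q |: H' by rewrite in_setU1 negb_or npq.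
have mpU : mate p \notin q |: H'.
  by apply: (lone_mate (parity_conf_vtx cH)) eH pU; rewrite lH in_set2 eqxx orbT.
have mpR : mate p \notin H' by move: mpU; rewrite in_setU1 negb_or => /andP[].
have mqS : mate q \notin S by rewrite !inE eqxx.
have paS : pa \in S by rewrite in_setD1 paH' andbT eq_sym.
have FR x : x \in H' -> (x \in paired H') = (x != pa) && (x != mate q).
  move=> xH; move/setP/(_ x): lH'; rewrite (lonesetE (parity_conf_vtx c')) xH in_set2 /=.
  by rewrite -negb_or => <-; rewrite negbK.
have I := phase_parity_near_far (corner_adj c) (corner_last c) eH' npq mqq (mate_corner c) pR qR mpR mqS paS FR
  (corner_prec c mqq).
rewrite (parity_conf_even c') andbF /= (prec_dir (etrans pv (esym qv))) in I.
have [rF eF] := paired_base_add qR mqH'.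
rewrite eH paired_base_lone // eF cardsU1 rF (xsumU1 _ rF) (sig_base_half iq).
have [-> ->] := corner_dirs c.
have -> : re_exp k (mate q).2 = true.
  rewrite (mateE mqq).2 /re_exp; case: c => _ _ [[_ ->]|[_ ->]]; by case: (k) => [[|[|[|[|d]]]] ld].
have -> : (true + #|paired_base H'| + 1 + false = #|paired_base H'| + 1 + true)%N by rewrite addn0 -addnA addnC.
congr (_ ^+ _ * _ * _); congr nat_of_bool; move: I.
have -> : re_sign k (mate q).2 = ~~ base q (+) (p.2 < q.2)%N (+) ((val p.2 == 0%N) && (val k == 3%N)).
  rewrite (mateE mqq).2 /re_sign /base; case: c => _ _ [[-> ->]|[-> ->]]; by case: (k) => [[|[|[|[|d]]]] ld].
move: (sheet_shift_mate iq); move: (phase_parity _ _ _) (phase_parity _ _ _) (xsum _ sig) (sheet_shift V sig p) (sheet_shift V sig q).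
move: (sheet_shift V sig (mate q)) (a.2) (_ && _) (base q) (_ < _)%N => b1 b2 b3 b4 b5 b6 b7 b8 b9 b10 <- h.
rewrite -[b7](addbK b6) h.
xor_tauto.
Qed.

Lemma corner_term_far_far p q s H : corner p q -> p != pa -> q != pa -> parity_conf V pa p H ->
  p \notin H -> q \in H -> corner_term p s H = corner_term q s (symdiff H [set p; q]).
Proof.
move=> c np nq cH pH qH; have c' := parity_conf_symdiff c cH; have npq := corner_neq c.
have [pv qv _] := c.
have pV : p.1 \in V by rewrite pv. have qV : q.1 \in V by rewrite qv.
set H' := symdiff _ _ in c' *.
have qH' : q \in H' = false by rewrite in_symdiff in_set2 eqxx orbT qH.
rewrite (corner_term_path Ba sigm _ _ _ np cH) // (corner_term_path Ba sigm _ _ _ nq c') //.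
rewrite /path_end (negbTE pH) qH'.
have [mpH nmp lH paH hp] := parity_conf_lone Ba pV np cH; rewrite /path_end (negbTE pH) in mpH nmp lH.
have ip : interior_half V p by case: hp; rewrite ?(negbTE pH).
have [mqH' nmq lH' paH' hq] := parity_conf_lone Ba qV nq c'; rewrite /path_end qH' in mqH' nmq lH'.
have iq : interior_half V q by case: hq; rewrite ?qH'.
have mqq := interior_neq iq; have mpp := interior_neq ip.
have mpq := mate_corner c; have mqp := mate_corner (cornerC c).
have nmm : mate p != mate q by rewrite (inj_eq (@mate_inj N M)).
have mqH : mate q \in H.
  by move: mqH'; rewrite in_symdiff in_set2 (negbTE mqq) (negbTE mqp) addbF.
pose T := H :\ mate p :\ q :\ mate q.
have eH : H = mate p |: (q |: (mate q |: T)).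
  apply/setP => x; rewrite !(in_setU1, in_setD1).
  have [->|_] := eqVneq x (mate p); first by rewrite mpH.
  have [->|_] := eqVneq x q; first by rewrite qH.
  by have [->|_] := eqVneq x (mate q); rewrite ?mqH.
have eH' : H' = mate q |: (p |: (mate p |: T)).
  apply/setP => x; rewrite !(in_symdiff, in_setU1, in_setD1, in_set1).
  have [->|_] := eqVneq x (mate q).
    by rewrite mqH (negbTE mqp) (negbTE mqq).
  have [->|_] := eqVneq x p; first by rewrite (negbTE pH).
  have [->|_] := eqVneq x (mate p).
    by rewrite mpH (negbTE mpq).
  by have [->|_] := eqVneq x q; rewrite ?qH // addbF.
have pT : p \notin T by rewrite !in_setD1 (negbTE pH) !andbF.
have qT : q \notin T by rewrite !in_setD1 eqxx !andbF.
have mpT : mate p \notin T by rewrite !in_setD1 eqxx !andbF.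
have mqT : mate q \notin T by rewrite !in_setD1 eqxx.
have paT : pa \in T.
  by rewrite !in_setD1 paH [pa == q]eq_sym [pa == _]eq_sym nmq nq eq_sym nmp.
have FT x : x \in T -> (x \in paired T) = (x != pa).
  move=> xT; have := xT; rewrite !in_setD1 => /and4P[x1 x2 x3 xH].
  move/setP/(_ x): lH; rewrite (lonesetE (parity_conf_vtx cH)) xH in_set2 (negbTE x3) orbF /= => <-.
  have y1 : mate x != mate q by rewrite (inj_eq (@mate_inj N M)).
  have y2 : mate x != q by rewrite mate_eq.
  have y3 : mate x != mate p.
    by rewrite (inj_eq (@mate_inj N M)); apply: contraNneq pH => <-.
  by rewrite negbK !in_paired xT xH !in_setD1 y1 y2 y3.
have I := phase_parity_far_far (corner_adj c) (corner_last c) npq mpp mqq nmm mpq pT qT mpT mqT paT FT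
  (corner_prec_mate (cornerC c) mpp) (corner_prec_mate c mqq).
have mpv : (mate p).1 == v = false by rewrite -pv (negbTE (mate_vtx mpp)).
have mqv : (mate q).1 == v = false by rewrite -qv (negbTE (mate_vtx mqq)).
have U1 : q \notin mate q |: T by rewrite in_setU1 negb_or eq_sym mqq.
have U2 : mate p \notin q |: (mate q |: T) by rewrite !in_setU1 !negb_or mpq nmm.
have U3 : p \notin mate p |: T by rewrite in_setU1 negb_or eq_sym mpp.
have U4 : mate q \notin p |: (mate p |: T) by rewrite !in_setU1 !negb_or mqp eq_sym nmm.
have eT : xsum T (fun x => x.1 == v) = true.
  have := parity_conf_even cH v; rewrite eH (xsumU1 _ U2) (xsumU1 _ U1) (xsumU1 _ mqT) mpv mqv qv eqxx.
  by case: (xsum _ _).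
rewrite eT andbT in I.
have [rq eq] := paired_base_add U1 (setU11 _ _); have [rp ep] := paired_base_add U3 (setU11 _ _).
have F1 : paired_base H = base_half q |: paired_base T.
  rewrite eH paired_base_lone ?mateK //; last by rewrite !in_setU1 !negb_or npq eq_sym mqp.
  by rewrite eq paired_base_lone // mateK.
have F2 : paired_base H' = base_half p |: paired_base T.
  rewrite eH' paired_base_lone ?mateK //; last by rewrite !in_setU1 !negb_or eq_sym npq eq_sym mpq.
  by rewrite ep paired_base_lone // mateK.
have rqT : base_half q \notin paired_base T by move: rq; rewrite paired_base_lone // mateK.
have rpT : base_half p \notin paired_base T by move: rp; rewrite paired_base_lone // mateK.
rewrite F1 F2 !cardsU1 rqT rpT (xsumU1 _ rqT) (xsumU1 _ rpT) !sig_base_half // eH eH'.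
have -> : re_exp k (mate p).2 = true.
  rewrite (mateE mpp).2 /re_exp; case: c => _ _ [[-> _]|[-> _]]; by case: (k) => [[|[|[|[|d]]]] ld].
have -> : re_exp k (mate q).2 = true.
  rewrite (mateE mqq).2 /re_exp; case: c => _ _ [[_ ->]|[_ ->]]; by case: (k) => [[|[|[|[|d]]]] ld].
congr (_ ^+ _ * _ * _); congr nat_of_bool; move: I.
have -> : re_sign k (mate q).2 = re_sign k (mate p).2 (+) ~~ (val k == 3%N) (+) base p (+) base q.
  rewrite (mateE mpp).2 (mateE mqq).2 /re_sign /base; case: c => _ _ [[-> ->]|[-> ->]];
    by case: (k) => [[|[|[|[|d]]]] ld].
move: (sheet_shift_mate iq) (sheet_shift_mate ip).
move: (phase_parity _ _ _) (phase_parity _ _ _) (xsum _ sig) (sheet_shift V sig p) (sheet_shift V sig q) (sheet_shift V sig (mate q)).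
move: (sheet_shift V sig (mate p)) (base p) (base q) (val k == _) (re_sign _ _) (a.2).
move=> b1 b2 b3 b4 b5 b6 b7 b8 b9 b10 b11 b12 <- <- h.
rewrite -[b8](addbK b7) h.
xor_tauto.
Qed.

Lemma odd_closed_mate (K : {set piece N M}) : paired K = K -> xsum K (fun=> true) = false.
Proof.
move=> FK; apply: (@xsum_invol _ _ _ (@mate N M)) => [x|x _|//]; last exact: mateK.
by rewrite -{1}FK in_paired => /and3P[].
Qed.

Lemma parity_conf_closed H : parity_conf V pa pa H -> paired H = H.
Proof.
move=> c; apply/setP => x; rewrite in_paired; case: (boolP (x \in H)) => //= xH.
move/setP/(_ x): (parity_conf_loop Ba c); rewrite (lonesetE (parity_conf_vtx c)) xH in_set0 /= => /negbFE.
by rewrite in_paired xH.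
Qed.

Lemma mate_start_notin H : (forall x, x \in H -> x.1 \in V) -> pa \notin H -> mate pa \notin H.
Proof.
move=> HV paH; apply/negP => h; have [e|n] := eqVneq (mate pa) pa.
  by rewrite e (negbTE paH) in h.
have [e _] := mateE n; move: (boundary_interiorF Ba).
by rewrite /interior_half (boundary_vtx Ba) e /= HV.
Qed.

Lemma corner_term_near_start q s H : corner pa q -> parity_conf V pa pa H -> q \notin H ->
  corner_term pa s H = corner_term q s (symdiff H [set pa; q]).
Proof.
move=> c cH qH; have c' := parity_conf_symdiff c cH; have npq := corner_neq c.
have nq : q != pa by rewrite eq_sym.
have [pv qv kk] := c; have qV : q.1 \in V by rewrite qv.
have paH := start_notin Ba cH.
set H' := symdiff _ _ in c' *.
have qH' : q \in H' by rewrite in_symdiff in_set2 eqxx orbT (negbTE qH).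
rewrite (corner_term_path Ba sigm _ _ _ nq c') // (corner_term_loop sig Ba _ erefl _ cH); last first.
  by case: kk => -[-> _]; [left|right].
rewrite /path_end qH'; have [_ _ lH' _ _] := parity_conf_lone Ba qV nq c'; rewrite /path_end qH' in lH'.
have eH' : H' = q |: (pa |: H).
  apply/setP => x; rewrite !(in_symdiff, in_setU1, in_set1).
  have [->|_] := eqVneq x q; first by rewrite (negbTE qH) orbT.
  by have [->|_] := eqVneq x pa; rewrite ?(negbTE paH) //= addbF.
have qU : q \notin pa |: H by rewrite in_setU1 negb_or nq.
have mqU : mate q \notin pa |: H.
  by apply: (lone_mate (parity_conf_vtx c')) eH' qU; rewrite lH' in_set2 eqxx orbT.
have mpH := mate_start_notin (parity_conf_vtx cH) paH.
have FH := parity_conf_closed cH; have ev := parity_conf_even cH; have oH := odd_closed_mate FH.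
rewrite eH' (phase_parity_near_start (corner_adj c) (corner_last c)) ?cross_parity_even //.
rewrite !paired_base_lone //.
have [-> ->] := corner_dirs (cornerC c); rewrite addn0.
congr (_ ^+ _ * _ * _); congr nat_of_bool.
rewrite (prec_dir (etrans qv (esym pv))).
have -> : (pa.2 == k) || (val k == 3%N) = ~~ (q.2 < pa.2)%N (+) ((val q.2 == 0%N) && (val k == 3%N)).
  case: kk => -[-> ->]; by case: (k) => [[|[|[|[|d]]]] ld].
move: (xsum _ sig) (sheet_shift V sig q) (a.2) (_ && _) (_ < _)%N => b1 b2 b3 b4 b5.
xor_tauto.
Qed.

Lemma corner_term_far_start q s H : corner pa q -> parity_conf V pa pa H -> q \in H ->
  corner_term pa s H = corner_term q s (symdiff H [set pa; q]).
Proof.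
move=> c cH qH; have c' := parity_conf_symdiff c cH; have npq := corner_neq c.
have nq : q != pa by rewrite eq_sym.
have [pv qv kk] := c; have qV : q.1 \in V by rewrite qv.
have paH := start_notin Ba cH.
set H' := symdiff _ _ in c' *.
have qH' : q \in H' = false by rewrite in_symdiff in_set2 eqxx orbT qH.
rewrite (corner_term_path Ba sigm _ _ _ nq c') // (corner_term_loop sig Ba _ erefl _ cH); last first.
  by case: kk => -[-> _]; [left|right].
have [mqH' nmq lH' _ hq] := parity_conf_lone Ba qV nq c'; rewrite /path_end qH' in mqH' nmq lH'.
have iq : interior_half V q by case: hq; rewrite ?qH'.
rewrite /path_end qH'.
have mqq := interior_neq iq; have mqp := mate_corner (cornerC c).
have FH := parity_conf_closed cH; have ev := parity_conf_even cH.
have mqH : mate q \in H by move: qH; rewrite -{1}FH in_paired => /and3P[].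
pose T := H :\ q :\ mate q.
have eH : H = q |: (mate q |: T).
  apply/setP => x; rewrite !(in_setU1, in_setD1).
  have [->|_] := eqVneq x q; first by rewrite qH.
  by have [->|_] := eqVneq x (mate q); rewrite ?mqH.
have eH' : H' = mate q |: (pa |: T).
  apply/setP => x; rewrite !(in_symdiff, in_setU1, in_setD1, in_set1).
  have [->|_] := eqVneq x (mate q).
    by rewrite mqH (negbTE mqp) (negbTE mqq).
  have [->|_] := eqVneq x pa; first by rewrite (negbTE paH).
  by have [->|_] := eqVneq x q; rewrite ?qH //= addbF.
have pT : pa \notin T by rewrite !in_setD1 (negbTE paH) !andbF.
have qT : q \notin T by rewrite !in_setD1 eqxx !andbF.
have mqT : mate q \notin T by rewrite !in_setD1 eqxx.
have mpT : mate pa \notin mate q |: T.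
  rewrite in_setU1 negb_or (inj_eq (@mate_inj N M)) npq /= !in_setD1.
  by rewrite (negbTE (mate_start_notin (parity_conf_vtx cH) paH)) !andbF.
have FT : paired T = T.
  apply/setP => x; rewrite in_paired; case: (boolP (x \in T)) => //= xT.
  move: (xT); rewrite !in_setD1 => /and3P[x1 x2 xH].
  move: xH; rewrite -{1}FH in_paired => /and3P[_ -> ->].
  have -> : mate x != mate q by rewrite (inj_eq (@mate_inj N M)).
  by have -> : mate x != q by rewrite mate_eq.
have U1 : q \notin mate q |: T by rewrite in_setU1 negb_or eq_sym mqq.
have Q0 : cross_parity (q |: (mate q |: T)) = false by rewrite -eH; apply: cross_parity_even.
have I := phase_parity_far_start (corner_adj c) (corner_last c) npq mqq mqp pT qT mqT mpT FT
  (odd_closed_mate FT) Q0 (corner_prec_mate c mqq).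
have mqv : (mate q).1 == v = false by rewrite -qv (negbTE (mate_vtx mqq)).
have eT : xsum T (fun x => x.1 == v) = true.
  have := ev v; rewrite eH (xsumU1 _ U1) (xsumU1 _ mqT) mqv qv eqxx.
  by case: (xsum _ _).
rewrite eT andbT -eH' in I; rewrite I.
have [rq eq] := paired_base_add U1 (setU11 _ _).
have F1 : paired_base H = base_half q |: paired_base T by rewrite eH eq paired_base_lone // mateK.
have mpT' : mate pa \notin T by move: mpT; rewrite in_setU1 negb_or => /andP[].
have F2 : paired_base H' = paired_base T.
  by rewrite eH' !paired_base_lone ?mateK // in_setU1 negb_or ?nq ?mqp.
have rqT : base_half q \notin paired_base T by move: rq; rewrite paired_base_lone // mateK.
rewrite F1 F2 !cardsU1 rqT (xsumU1 _ rqT) !sig_base_half //.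
have -> : re_exp k (mate q).2 = true.
  rewrite (mateE mqq).2 /re_exp; case: kk => -[_ ->]; by case: (k) => [[|[|[|[|d]]]] ld].
have -> : (true + #|paired_base T| + 1 = #|paired_base T| + 1 + true)%N by rewrite -addnA addnC.
congr (_ ^+ _ * _ * _); congr nat_of_bool.
have -> : re_sign k (mate q).2 = ~~ ((pa.2 == k) || (val k == 3%N) (+) (val k == 3%N) (+) base q).
  rewrite (mateE mqq).2 /re_sign /base; case: kk => -[-> ->]; by case: (k) => [[|[|[|[|d]]]] ld].
rewrite -(sheet_shift_mate iq).
move: (xsum _ sig) (_ == k) (val k == _) => b1 b2 b3.
xor_tauto.
Qed.

Lemma corner_term_symdiff p q s H : corner p q -> parity_conf V pa p H ->
    corner_term p s H = corner_term q s (symdiff H [set p; q]).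
Proof.
move=> c cH; have c' := parity_conf_symdiff c cH; have npq := corner_neq c; have cc := cornerC c.
have eD : [set p; q] = [set q; p] by rewrite setUC.
have pq' : p \in [set p; q] by rewrite in_set2 eqxx.
have qq' : q \in [set p; q] by rewrite in_set2 eqxx orbT.
have [ep|np] := eqVneq p pa.
  move: c cH; rewrite ep => c cH.
  by case: (boolP (q \in H)); [apply: corner_term_far_start | apply: corner_term_near_start].
have rev : corner_term q s (symdiff H [set p; q]) = corner_term p s (symdiff (symdiff H [set p; q]) [set q; p]) ->
    corner_term p s H = corner_term q s (symdiff H [set p; q]) by move=> ->; rewrite -eD symdiffK.
have [eq|nq] := eqVneq q pa.
  apply: rev; move: c' cc; rewrite {}eq => c' cc.
  by case: (boolP (p \in symdiff H [set p; pa])); [apply: corner_term_far_start | apply: corner_term_near_start].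
case: (boolP (p \in H)) => pH; case: (boolP (q \in H)) => qH.
- exact: corner_term_near_far.
- exact: corner_term_near_near.
- exact: corner_term_far_far.
apply/rev/corner_term_near_far => //.
  by rewrite in_symdiff (negbTE qH) qq'.
by rewrite in_symdiff (negbTE pH) pq'.
Qed.

End Main.

Lemma Re_Fobs (N M : nat) (V : {set vtx N M}) (sig : piece N M -> bool)
    (a z : piece N M * bool) (e : algC) :
  'Re (e * Fobs V sig a z) = \sum_(H | conf V a.1 z.1 H)
    'Re (e * ('i * eta_dir a.1.2 * (Wt V sig a z H * xweight V H))).
Proof. by rewrite /Fobs !mulr_sumr raddf_sum. Qed.

Lemma Pr_corner (N M : nat) (V : {set vtx N M}) (sig : piece N M -> bool)
    (a : piece N M * bool) (v : vtx N M) (k : 'I_4) (s : bool) :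
  boundary V a.1 -> (forall p, interior_half V p -> sig (mate p) = sig p) -> v \in V ->
  Pr (eta_corner k) (Fobs V sig a (liftp V sig (v, k) s)) =
  Pr (eta_corner k) (Fobs V sig a (liftp V sig (v, ordS k) s)).
Proof.
move=> Ba sigm vV; rewrite /Pr; congr (_ * _); rewrite !Re_Fobs.
set p := (v, k); set q := (v, ordS k).
have c : corner v k p q by split=> //; left.
have cc := cornerC c.
have E y : (liftp V sig y s).1 = canon_piece V sig y by rewrite liftpE.
pose D := [set p; q].
have inj : injective (fun H : {set piece N M} => symdiff H D).
  by apply: inv_inj => H; apply: symdiffK.
rewrite (reindex_inj inj) /=.
apply: eq_big => [H|H].
  rewrite !E; apply/idP/idP => h.
    apply: conf_of_parity => //; rewrite -(symdiffK H D).
    by apply: (parity_conf_symdiff vV c); apply: (parity_of_conf Ba (sig := sig)).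
  apply: conf_of_parity => //; rewrite /D setUC.
  by apply: (parity_conf_symdiff vV cc); apply: (parity_of_conf Ba (sig := sig)).
rewrite E => h.
have cf1 : parity_conf V a.1 p (symdiff H D) by apply: parity_of_conf h.
have := corner_term_symdiff Ba sigm vV s c cf1.
by rewrite symdiffK.
Qed.

Lemma Pr_boundary (N M : nat) (V : {set vtx N M}) (sig : piece N M -> bool)
    (a b : piece N M * bool) :
  boundary V a.1 -> (forall p, interior_half V p -> sig (mate p) = sig p) ->
  boundary V b.1 -> b.1 != a.1 ->
  Pr ('i * eta_dir b.1.2) (Fobs V sig a b) = 0.
Proof.
move=> Ba sigm Bb nb; rewrite /Pr Re_Fobs big1 ?mul0r // => H h.
have ib := boundary_interiorF Bb.
have eb : b = liftp V sig b.1 b.2 by rewrite /liftp ib /= -surjective_pairing.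
have cb : canon_piece V sig b.1 = b.1 by rewrite canon_pieceE ib.
have c : parity_conf V a.1 b.1 H by apply: (parity_of_conf Ba (sig := sig)); rewrite ?cb ?(boundary_vtx Bb).
have bH : b.1 \in H.
  by have [_ _ _ _ []] := parity_conf_lone Ba (boundary_vtx Bb) nb c; rewrite ?ib.
have := Wt_path Ba sigm b.2 (boundary_vtx Bb) nb c; rewrite -eb /path_end bH -eta_dirE => e.
rewrite [_ * (_ * xweight _ _)]mulrA e xweightE; last exact: parity_conf_vtx c.
have -> : sqrtC xcrit ^+ #|loneset V H| = xcrit ^+ 1.
  have [_ _ -> _ _] := parity_conf_lone Ba (boundary_vtx Bb) nb c.
  by rewrite cards2 /path_end bH eq_sym nb sqrtCK expr1.
rewrite rmorphM /= conjCi eta_dirE omega_conjz opprK.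
set A := omega ^ _; set B := omega ^ _; set S := _ ^+ _.
have AB : A * B = 1 by rewrite -expfzDr ?omega_neq0 // subrr expr0z.
set X := xcrit ^+ _; set Y := xcrit ^+ 1.
have -> : - 'i * A * (S * B * (X * Y)) = - 'i * (S * (X * Y)).
  by rewrite -!mulrA; congr (_ * _); rewrite [A * _]mulrCA [A * _]mulrA AB mul1r.
rewrite mulNr raddfN /= ReMr ?Re_i ?mul0r ?oppr0 //.
by rewrite !rpredM ?sign_real ?xcrit_real.
Qed.

Theorem theorem3p2 (N M : nat) (V Fc : {set vtx N M}) (sig : piece N M -> bool)
    (a : piece N M * bool) :
  discrete_domain V Fc -> double_cover V Fc sig -> boundary V a.1 ->
  (forall (v : vtx N M) (k : 'I_4) (s : bool), v \in V ->
     Pr (eta_corner k) (Fobs V sig a (liftp V sig (v, k) s)) =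
     Pr (eta_corner k) (Fobs V sig a (liftp V sig (v, ordS k) s)))
  /\
  (forall b : piece N M * bool, boundary V b.1 -> b != a -> b != (a.1, ~~ a.2) ->
     Pr ('i * eta_dir b.1.2) (Fobs V sig a b) = 0).
Proof.
move=> _ [sigm _] Ba; split=> [v k s vV|b Bb n1 n2]; first exact: Pr_corner.
apply: Pr_boundary => //; apply/eqP => e.
case: a b {Ba Bb} e n1 n2 => [pa sa] [pb sb] /= ->; rewrite !xpair_eqE !eqxx /=.
by case: sa; case: sb.
Qed.
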